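(* Let $M$ be a compact strictly pseudoconvex CR manifold of CR dimension $n$ and let $\theta$ be a contact form on $M$ such that the Levi form $G_\theta$ is positive definite. Then for every $f \in C^\infty(M)$ $$\frac{1}{2}\,\Delta_b\big(|\nabla^H f|^2\big) = |\pi_H \nabla^2 f|^2 + (\nabla^H f)(\Delta_b f) + \rho(\nabla^H f, \nabla^H f) + 2\,Lf ,$$ where $L$ is the differential operator $$Lf = (J\nabla^H f)(Tf) - (J\nabla_T \nabla^H f)(f).$$
   Context: A CR manifold $(M,T_{1,0}(M))$ of CR dimension $n$ is an oriented smooth $(2n+1)$-dimensional manifold with a complex rank $n$ involutive subbundle $T_{1,0}(M)\subset T(M)\otimes\mathbb{C}$ with $T_{1,0}(M)\cap T_{0,1}(M)=(0)$, $T_{0,1}(M)=\overline{T_{1,0}(M)}$. $H(M)=\mathrm{Re}\{T_{1,0}(M)\oplus T_{0,1}(M)\}$, with complex structure $J(Z+\overline Z)=i(Z-\overline Z)$, $Z\in T_{1,0}(M)$. A pseudohermitian structure is a real $1$-form $\theta$ with $\mathrm{Ker}(\theta)=H(M)$; the Levi form is $G_\theta(X,Y)=(d\theta)(X,JY)$, $X,Y\in H(M)$ (exterior derivative normalized by $2\,d\theta(X,Y)=X(\theta(Y))-Y(\theta(X))-\theta([X,Y])$). $M$ is strictly pseudoconvex if $G_\theta$ is definite; $\theta$ is chosen so that $G_\theta$ is positive definite, and $\theta$ is then a contact form. $T$ (the characteristic direction of $d\theta$) is the vector field with $\theta(T)=1$, $T\rfloor d\theta=0$; $J$ is extended by $JT=0$.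 The Webster metric is the Riemannian metric $g_\theta$ with $g_\theta=G_\theta$ on $H(M)$, $g_\theta(X,T)=0$ for $X\in H(M)$, $g_\theta(T,T)=1$. $\pi_H:T(M)\to H(M)$ is the projection relative to $T(M)=H(M)\oplus\mathbb{R}T$. The Tanaka-Webster connection $\nabla$ is the unique linear connection on $M$ such that $H(M)$ is $\nabla$-parallel, $\nabla g_\theta=0$, $\nabla J=0$, and its torsion $T_\nabla$ satisfies $T_\nabla(Z,W)=0$, $T_\nabla(Z,\overline W)=2iG_\theta(Z,\overline W)T$ for $Z,W\in T_{1,0}(M)$ ($G_\theta$ extended $\mathbb{C}$-bilinearly), and $\tau\circ J+J\circ\tau=0$, where $\tau(X)=T_\nabla(T,X)$. The horizontal gradient is $\nabla^H f=\pi_H\nabla f$, where $g_\theta(\nabla f,X)=X(f)$; the sublaplacian is $\Delta_b f=\mathrm{div}(\nabla^H f)$ (divergence with respect to $g_\theta$). $|\cdot|$ on vectors is the $g_\theta$-norm. The Hessian is $(\nabla^2 f)(X,Y)=X(Y(f))-(\nabla_XY)f$; $\pi_H\nabla^2 f$ is its restriction to $H(M)$, and $|\pi_H\nabla^2 f|^2=\sum_{j,k=1}^{2n}(\nabla^2f)(X_j,X_k)^2$ for any local $G_\theta$-orthonormal frame $\{X_j\}$ of $H(M)$. $\rho(X,Y)=\mathrm{trace}\{Z\mapsto R(Z,Y)X\}$ with $R$ the curvature tensor of $\nabla$, $R(X,Y)=\nabla_X\nabla_Y-\nabla_Y\nabla_X-\nabla_{[X,Y]}$. *)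

(* Defs.v *)
From HB Require Import structures.
From mathcomp Require Import all_boot all_order all_algebra.
From mathcomp Require Import all_classical all_reals all_analysis.
From mathcomp Require Import complex.

Set Implicit Arguments.
Unset Strict Implicit.
Unset Printing Implicit Defensive.

Import Order.TTheory GRing.Theory Num.Theory.
Import numFieldNormedType.Exports.

Local Open Scope classical_set_scope.
Local Open Scope ring_scope.

(** * Smooth maps between normed spaces *)

Section SmoothMaps.
Context {R : realType} {V W : normedModType R}.

Fixpoint Ck (k : nat) (A : set V) (f : V -> W) : Prop :=
  if k is k'.+1 then
    (forall x, A x -> differentiable f x) /\
    (forall v, Ck k' A (fun x => 'D_v f x))
  else forall x, A x -> {for x, continuous f}.

(* Only meaningful for open A. *)
Definition smooth (A : set V) (f : V -> W) : Prop := forall k, Ck k A f.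

End SmoothMaps.

(** * Oriented smooth manifolds *)

(* chart_map is meaningful on chart_dom only, chart_inv on its image only. *)
Record chart (R : realType) (d : nat) (M : topologicalType) := Chart {
  chart_dom : set M ;
  chart_map :> M -> 'rV[R]_d ;
  chart_inv : 'rV[R]_d -> M ;
  chart_dom_open : open chart_dom ;
  chart_img_open : open (chart_map @` chart_dom) ;
  chart_mapK : forall p, chart_dom p -> chart_inv (chart_map p) = p ;
  chart_map_continuous : forall p, chart_dom p -> {for p, continuous chart_map} ;
  chart_inv_continuous : forall x, (chart_map @` chart_dom) x ->
    {for x, continuous chart_inv} }.

(* The orientation is the one for which all the charts of the atlas are
   positive. Every point comes with a preferred chart around it, which is used
   below to identify the tangent space with R^d. *)
Record orientedManifold (R : realType) (d : nat) := OrientedManifold {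
  mcarrier :> topologicalType ;
  atlas : set (chart R d mcarrier) ;
  chart_at : mcarrier -> chart R d mcarrier ;
  mhausdorff : hausdorff_space mcarrier ;
  msecond_countable : @second_countable mcarrier ;
  chart_at_atlas : forall p, atlas (chart_at p) ;
  chart_at_dom : forall p, chart_dom (chart_at p) p ;
  transition_smooth : forall c c', atlas c -> atlas c' ->
    smooth (c @` (chart_dom c `&` chart_dom c')) (c' \o chart_inv c) ;
  transition_positive : forall c c' x, atlas c -> atlas c' ->
    (c @` (chart_dom c `&` chart_dom c')) x ->
    0 < \det ('J (c' \o chart_inv c) x) }.

Section Calculus.
Context {R : realType} {d : nat} {M : orientedManifold R d}.

Definition smooth_on (U : set M) (f : M -> R) : Prop :=
  forall c, atlas c -> smooth (c @` (chart_dom c `&` U)) (f \o chart_inv c).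

(* A tangent vector at p is represented by its components in the chart
   chart_at p; hence two values of a vector field at distinct points must not
   be compared directly. *)
Definition vfield := M -> 'rV[R]_d.

(* v(f), for v tangent at p *)
Definition dirder (f : M -> R) (p : M) (v : 'rV[R]_d) : R :=
  'D_v (f \o chart_inv (chart_at p)) (chart_at p p).

(* X(f) *)
Definition vder (X : vfield) (f : M -> R) : M -> R :=
  fun q => dirder f q (X q).

Definition coord (c : chart R d M) (j : 'I_d) : M -> R := fun q => c q 0 j.

Definition smooth_vf (U : set M) (X : vfield) : Prop :=
  forall c j, atlas c -> smooth_on (U `&` chart_dom c) (vder X (coord c j)).

(* The vector field on chart_dom c with constant components v in the chart c *)
Definition chart_vf (c : chart R d M) (v : 'rV[R]_d) : vfield :=
  fun q => 'D_v (chart_at q \o chart_inv c) (c q).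

(* A local extension of the tangent vector v at p, used to evaluate tensorial
   expressions in vector fields at tangent vectors. *)
Definition extend (p : M) (v : 'rV[R]_d) : vfield := chart_vf (chart_at p) v.

Definition lie (X Y : vfield) : vfield := fun p =>
  \row_j (vder X (vder Y (coord (chart_at p) j)) p -
          vder Y (vder X (coord (chart_at p) j)) p).

Definition oneform := M -> 'rV[R]_d -> R.

Definition is_oneform (theta : oneform) : Prop :=
  (forall p, linear (theta p : 'rV[R]_d -> R^o)) /\
  (forall c v, atlas c ->
     smooth_on (chart_dom c) (fun q => theta q (chart_vf c v q))).

(* 2 dtheta(X, Y) = X(theta(Y)) - Y(theta(X)) - theta([X, Y]) *)
Definition extder_vf (theta : oneform) (X Y : vfield) : M -> R := fun q =>
  2^-1 * (vder X (fun r => theta r (Y r)) q - vder Y (fun r => theta r (X r)) q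
          - theta q (lie X Y q)).

Definition extder (theta : oneform) (p : M) (v w : 'rV[R]_d) : R :=
  extder_vf theta (extend p v) (extend p w) p.

(** ** Linear connections *)

(* nabla p v Y is the covariant derivative at p of the (locally defined)
   vector field Y in the direction v. *)
Definition connection := M -> 'rV[R]_d -> vfield -> 'rV[R]_d.

Definition cov (nabla : connection) (X Y : vfield) : vfield :=
  fun q => nabla q (X q) Y.

Record is_connection (nabla : connection) : Prop := IsConnection {
  conn_smooth : forall U X Y, open U -> smooth_vf U X -> smooth_vf U Y ->
    smooth_vf U (cov nabla X Y) ;
  conn_local : forall U Y Y' p v, open U -> U p ->
    smooth_vf U Y -> smooth_vf U Y' -> (forall q, U q -> Y q = Y' q) ->
    nabla p v Y = nabla p v Y' ;
  conn_linear : forall U Y p, open U -> U p -> smooth_vf U Y ->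
    linear (fun v => nabla p v Y) ;
  conn_additive : forall U Y Y' p v, open U -> U p ->
    smooth_vf U Y -> smooth_vf U Y' ->
    nabla p v (fun q => Y q + Y' q) = nabla p v Y + nabla p v Y' ;
  conn_leibniz : forall U f Y p v, open U -> U p ->
    smooth_on U f -> smooth_vf U Y ->
    nabla p v (fun q => f q *: Y q) =
    dirder f p v *: Y p + f p *: nabla p v Y }.

Definition torsion (nabla : connection) (X Y : vfield) : vfield :=
  fun q => cov nabla X Y q - cov nabla Y X q - lie X Y q.

Definition curvature (nabla : connection) (X Y Z : vfield) : vfield := fun q =>
  cov nabla X (cov nabla Y Z) q - cov nabla Y (cov nabla X Z) q
  - cov nabla (lie X Y) Z q.

(* rho(X, Y) = trace {Z |-> R(Z, Y)X} *)
Definition ricci (nabla : connection) (X Y : vfield) : M -> R := fun p =>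
  \tr (lin1_mx (fun z => curvature nabla (extend p z) Y X p)).

Definition hessian (nabla : connection) (f : M -> R) (X Y : vfield) : M -> R :=
  fun p => vder X (vder Y f) p - vder (cov nabla X Y) f p.

(** ** Metrics *)

Definition is_metric_connection (g : M -> 'rV[R]_d -> 'rV[R]_d -> R)
    (nabla : connection) : Prop :=
  forall U X Y p v, open U -> U p -> smooth_vf U X -> smooth_vf U Y ->
    dirder (fun q => g q (X q) (Y q)) p v =
    g p (nabla p v X) (Y p) + g p (X p) (nabla p v Y).

Definition is_levi_civita (g : M -> 'rV[R]_d -> 'rV[R]_d -> R)
    (D : connection) : Prop :=
  [/\ is_connection D, is_metric_connection g D &
      forall U X Y p, open U -> U p -> smooth_vf U X -> smooth_vf U Y ->
        torsion D X Y p = 0].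

(* The Riemannian divergence, when D is the Levi-Civita connection *)
Definition divergence (D : connection) (X : vfield) : M -> R := fun p =>
  \tr (lin1_mx (fun z => D p z X)).

Definition gradient (g : M -> 'rV[R]_d -> 'rV[R]_d -> R) (f : M -> R) : vfield :=
  fun p => xget 0 [set u | forall v, g p u v = dirder f p v].

(** ** The complexified tangent bundle *)

Definition cvfield := M -> 'rV[R[i]]_d.

Definition re_vec (z : 'rV[R[i]]_d) : 'rV[R]_d := map_mx (@complex.Re R) z.
Definition im_vec (z : 'rV[R[i]]_d) : 'rV[R]_d := map_mx (@complex.Im R) z.

Definition re_vf (Z : cvfield) : vfield := fun q => re_vec (Z q).
Definition im_vf (Z : cvfield) : vfield := fun q => im_vec (Z q).

Definition smooth_cvf (U : set M) (Z : cvfield) : Prop :=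
  smooth_vf U (re_vf Z) /\ smooth_vf U (im_vf Z).

Definition to_complex (v : 'rV[R]_d) : 'rV[R[i]]_d := map_mx (real_complex R) v.

Definition conj_vec (z : 'rV[R[i]]_d) : 'rV[R[i]]_d := map_mx conjc z.

(* C-bilinear extension of a real bilinear operation on vector fields *)
Definition cbilin_vf (B : vfield -> vfield -> vfield) (Z W : cvfield) : cvfield :=
  fun q =>
    to_complex (B (re_vf Z) (re_vf W) q - B (im_vf Z) (im_vf W) q) +
    'i%C *: to_complex (B (re_vf Z) (im_vf W) q + B (im_vf Z) (re_vf W) q).

(* C-bilinear extension of a real bilinear form *)
Definition cbilin_form (B : 'rV[R]_d -> 'rV[R]_d -> R) (z w : 'rV[R[i]]_d) : R[i] :=
  Complex (B (re_vec z) (re_vec w) - B (im_vec z) (im_vec w))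
          (B (re_vec z) (im_vec w) + B (im_vec z) (re_vec w)).

End Calculus.

Arguments vfield {R d} M.
Arguments cvfield {R d} M.
Arguments oneform {R d} M.
Arguments connection {R d} M.

(** * CR manifolds *)

Definition is_section {R : realType} {d : nat} {M : orientedManifold R d}
    (T10 : M -> set 'rV[R[i]]_d) (U : set M) (Z : cvfield M) : Prop :=
  smooth_cvf U Z /\ forall q, U q -> T10 q (Z q).

Record crManifold (R : realType) (n : nat) := CRManifold {
  cr_manifold :> orientedManifold R (2 * n).+1 ;
  T10 : cr_manifold -> set 'rV[R[i]]_(2 * n).+1 ;
  T10_subbundle : forall p, exists (U : set cr_manifold)
      (E : 'I_n -> cvfield cr_manifold),
    [/\ open U, U p, forall i, smooth_cvf U (E i) &
        forall q, U q -> let A := \matrix_(i < n) E i q in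
          row_free A /\ T10 q = [set z | (z <= A)%MS]] ;
  T10_involutive : forall U Z W, open U ->
    is_section T10 U Z -> is_section T10 U W ->
    forall q, U q -> T10 q (cbilin_vf lie Z W q) ;
  T10_T01 : forall p z, T10 p z -> (exists2 w, T10 p w & z = conj_vec w) ->
    z = 0 }.

Section Pseudohermitian.
Context {R : realType} {n : nat} {M : crManifold R n}.
Let vec := 'rV[R]_(2 * n).+1.

(* H(M) = Re {T10 + T01} *)
Definition Hb (p : M) : set vec :=
  [set v | exists z w, [/\ T10 p z, T10 p w &
                           v = re_vec (z + conj_vec w)]].

(* J(Z + conj Z) = i(Z - conj Z); the value outside H(M) is a default one *)
Definition JH (p : M) (v : vec) : vec :=
  xget 0 [set w | exists2 z, T10 p z &
    to_complex v = z + conj_vec z /\ to_complex w = 'i%C *: (z - conj_vec z)].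

Definition is_pseudohermitian (theta : oneform M) : Prop :=
  is_oneform theta /\ forall p, [set v | theta p v = 0] = Hb p.

(* Only meaningful on H(M) *)
Definition levi_form (theta : oneform M) (p : M) (v w : vec) : R :=
  extder theta p v (JH p w).

Definition levi_posdef (theta : oneform M) : Prop :=
  forall p v, Hb p v -> v != 0 -> 0 < levi_form theta p v v.

Definition is_characteristic (theta : oneform M) (T : vfield M) : Prop :=
  smooth_vf setT T /\
  forall p, theta p (T p) = 1 /\ forall v, extder theta p (T p) v = 0.

(* projection on H(M) along T *)
Definition piH (theta : oneform M) (T : vfield M) (p : M) (v : vec) : vec :=
  v - theta p v *: T p.

(* J extended by J T = 0 *)
Definition Jext (theta : oneform M) (T : vfield M) (p : M) (v : vec) : vec :=
  JH p (piH theta T p v).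

Definition webster (theta : oneform M) (T : vfield M) (p : M) (v w : vec) : R :=
  levi_form theta p (piH theta T p v) (piH theta T p w) + theta p v * theta p w.

Definition Jvf (theta : oneform M) (T X : vfield M) : vfield M :=
  fun q => Jext theta T q (X q).

Record is_tanaka_webster (theta : oneform M) (T : vfield M)
    (nabla : connection M) : Prop := IsTanakaWebster {
  tw_connection : is_connection nabla ;
  tw_H_parallel : forall U Y p v, open U -> U p -> smooth_vf U Y ->
    (forall q, U q -> Hb q (Y q)) -> Hb p (nabla p v Y) ;
  tw_metric : is_metric_connection (webster theta T) nabla ;
  tw_J_parallel : forall U Y p v, open U -> U p -> smooth_vf U Y ->
    nabla p v (Jvf theta T Y) = Jext theta T p (nabla p v Y) ;
  tw_torsion_ZW : forall U Z W p, open U -> U p ->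
    is_section (@T10 R n M) U Z -> is_section (@T10 R n M) U W ->
    cbilin_vf (torsion nabla) Z W p = 0 ;
  tw_torsion_ZWbar : forall U Z W p, open U -> U p ->
    is_section (@T10 R n M) U Z -> is_section (@T10 R n M) U W ->
    cbilin_vf (torsion nabla) Z (fun q => conj_vec (W q)) p =
    (2 * 'i%C * cbilin_form (levi_form theta p) (Z p) (conj_vec (W p)))
      *: to_complex (T p) ;
  tw_torsion_J : forall U X p, open U -> U p -> smooth_vf U X ->
    torsion nabla T (Jvf theta T X) p + Jext theta T p (torsion nabla T X p) = 0 }.

(** ** Horizontal calculus *)

Definition hgrad (theta : oneform M) (T : vfield M) (f : M -> R) : vfield M :=
  fun q => piH theta T q (gradient (webster theta T) f q).

(* D is meant to be the Levi-Civita connection of the Webster metric *)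
Definition sublaplacian (theta : oneform M) (T : vfield M) (D : connection M)
    (f : M -> R) : M -> R :=
  divergence D (hgrad theta T f).

Definition sqnorm (theta : oneform M) (T : vfield M) (X : vfield M) : M -> R :=
  fun q => webster theta T q (X q) (X q).

Definition is_orthonormal_Hframe (theta : oneform M) (U : set M)
    (E : 'I_(2 * n) -> vfield M) : Prop :=
  (forall j, smooth_vf U (E j)) /\
  (forall q, U q -> (forall j, Hb q (E j q)) /\
     forall j k, levi_form theta q (E j q) (E k q) = (j == k)%:R).

(* The squared norm of pi_H nabla^2 f, computed in an orthonormal frame E *)
Definition sqnorm_hessian (nabla : connection M) (f : M -> R)
    (E : 'I_(2 * n) -> vfield M) : M -> R := fun p =>
  \sum_(j < 2 * n) \sum_(k < 2 * n) hessian nabla f (E j) (E k) p ^+ 2.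

(* L f = (J nabla^H f)(T f) - (J nabla_T nabla^H f)(f) *)
Definition Lop (theta : oneform M) (T : vfield M) (nabla : connection M)
    (f : M -> R) : M -> R := fun p =>
  vder (Jvf theta T (hgrad theta T f)) (vder T f) p -
  vder (Jvf theta T (cov nabla T (hgrad theta T f))) f p.

End Pseudohermitian.

(* Main.v *)
Require Import Defs.
From mathcomp Require Import all_boot all_order all_algebra.
From mathcomp Require Import all_classical all_reals all_analysis.
From mathcomp Require Import complex ring lra.

Set Implicit Arguments.
Unset Strict Implicit.
Unset Printing Implicit Defensive.

Import Order.TTheory GRing.Theory Num.Theory.
Import numFieldNormedType.Exports.

Local Open Scope classical_set_scope.
Local Open Scope ring_scope.

Local Notation coord := Defs.coord.

(* Write u for the horizontal gradient of f. The torsion of horizontal vectors is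
   tau(X, Y) = 2 dtheta(X, Y) T, so the horizontal Hessian is symmetric up to
   -2 dtheta(X, Y) Tf. Comparing g(nabla_X u, u) with g(nabla_u u, X) this gives
   grad^H |u|^2 = 2 nabla_u u + 4 (Tf) J u. Both sides are horizontal fields, and
   the divergence of such a field X is sum_j g(nabla_{E_j} X, E_j): the trace of
   the torsion does not contribute. In the divergence of nabla_u u one commutes
   nabla_{E_j} and nabla_u, which yields the Ricci term and u(Delta_b f); the
   bracket [E_j, u] gives sum_{jk} f_jk f_kj and the term in nabla_T u. The excess
   of sum f_jk f_kj over |pi_H Hess f|^2 cancels the term Tf div(J u). *)

(** * Smooth functions on normed spaces *)

(** No frame parallel at p is constructed, so the coefficients c_ij = g(nabla_u E_i, E_j) survive in
    two places: in the bracket [E_j, u] and in the derivative along u of sum_j g(nabla_{E_j} u,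
    E_j). Metric compatibility makes c antisymmetric, and the two contributions cancel. The factor 2
    of L has two sources. Half of 4 (Tf) J u contributes 2 (J u)(Tf) when its divergence
    differentiates Tf; the torsion term 2 dtheta(E_j, u) T of the bracket contributes 2 g(nabla_T u,
    J u), which is -2 (J nabla_T u)(f) because J is skew. The real torsion law on H(M) is not an
    axiom: the axioms concern sections of type (1,0). Their real parts show that the torsion is
    vertical, and applying theta then identifies the coefficient. Tangent vectors at distinct points
    are written in different preferred charts, and tensors take their values on vectors through
    [extend]. So dtheta, torsion and curvature must be shown linear over smooth functions before a
    frame can be inserted. *)

Section SmoothCalculus.
Context {R : realType}.
Implicit Types V W : normedModType R.

(** The difference g - f vanishes near x, so the zero map is its differential there. This makes
    differentiability a property of germs, as needed for chart expressions that are meaningful on an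
    open set only. *)
Lemma near_eq_differentiable V W (f g : V -> W) (x : V) :
  (\near x, f x = g x) -> differentiable f x -> differentiable g x.
Proof.
move=> fg df; pose e : V -> W := fun y => g y - f y.
have e0 : e \o shift x = cst (e x) + (\0 : V -> W) +o_ 0 id.
  apply/eqaddoP => _/posnumP[eps].
  have ne : \forall y \near x, e y = 0.
    by near=> y; rewrite /e (near fg y)//= subrr.
  rewrite (near_shift 0) subr0 in ne; near=> h.
  have ehx : e (h + x) = 0 by exact: (near ne h).
  rewrite -![(_ + _ : _ -> _) _]/(_ + _) -![(- _ : _ -> _) _]/(- _) /cst /=.
  rewrite ehx /e (nbhs_singleton fg) subrr.
  rewrite addr0 subrr normr0 mulr_ge0//.
have de : differentiable e x.
  have c0 : continuous (\0 : V -> W) by move=> ?; exact: cvg_cst.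
  have E := diff_unique c0 e0.
  by apply/diff_locallyP; rewrite E; split.
rewrite (_ : g = f + e); first exact: differentiableD.
by apply/funext => y; rewrite /e -[RHS]/(f y + (g y - f y)) addrC subrK.
Unshelve. all: by end_near. Qed.

Lemma derive_coord V (d : nat) (f : V -> 'rV[R]_d) (x v : V) (j : 'I_d) :
  differentiable f x -> ('D_v f x) 0 j = 'D_v (fun y => f y 0 j) x.
Proof.
by move=> df; rewrite (derive_mx (diff_derivable df)) mxE.
Qed.

Lemma differentiable_coordf V (d : nat) (f : V -> 'rV[R]_d) (x : V) (j : 'I_d) :
  differentiable f x -> differentiable (fun y => f y 0 j : R) x.
Proof.
move=> df; apply: (@differentiable_comp _ _ _ _ f (fun N : 'rV[R]_d => N 0 j : R)) => //.
exact: differentiable_coord.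
Qed.

(** * Closure properties of C^k maps on an open set *)

Section CkBasic.
Context {V W : normedModType R}.
Implicit Types (A : set V) (f g : V -> W).

(** On an open set, agreement on A is agreement near each of its points, so the directional
    derivatives agree on A again and the induction goes through. *)
Lemma eq_Ck k A f g : open A -> {in A, f =1 g} -> Ck k A f -> Ck k A g.
Proof.
move=> oA; elim: k f g => [|k IH] f g fg /=.
  move=> cf x Ax; rewrite /prop_for /continuous_at -fg ?inE//.
  apply: cvg_trans (cf x Ax); apply: near_eq_cvg.
  by near=> y; apply: fg; rewrite inE; near: y; exact: open_nbhs_nbhs.
have nfg x : A x -> \near x, f x = g x.
  by move=> Ax; near=> y; apply: fg; rewrite inE; near: y; exact: open_nbhs_nbhs.
case=> df Df; split=> [x Ax|v].
  by apply: near_eq_differentiable (df x Ax); exact: nfg.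
apply: IH (Df v) => x; rewrite inE => Ax.
by apply: near_eq_derive; exact: nfg.
Unshelve. all: by end_near. Qed.

Lemma sub_Ck k A B f : A `<=` B -> Ck k B f -> Ck k A f.
Proof.
move=> AB; elim: k f => [|k IH] f /=; first by move=> cf x /AB; exact: cf.
by case=> df Df; split=> [x /AB/df//|v]; exact: IH.
Qed.

Lemma Ck_pred k A f : Ck k.+1 A f -> Ck k A f.
Proof.
elim: k f => [|k IH] f.
  by case=> df _ x Ax; exact/differentiable_continuous/df.
by case=> df Df; split=> // v; exact/IH/Df.
Qed.

Lemma Ck_cst k A (w : W) : Ck k A (fun _ => w).
Proof.
elim: k w => [|k IH] w /=; first by move=> x _; exact: cvg_cst.
split=> [x _|v]; first exact: differentiable_cst.
have -> : (fun x : V => 'D_v (fun=> w) x) = (fun=> 0); last exact: IH.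
by apply/funext => x; rewrite derive_cst.
Qed.

Lemma CkD k A f g : open A -> Ck k A f -> Ck k A g -> Ck k A (fun x => f x + g x).
Proof.
move=> oA; elim: k f g => [|k IH] f g /=.
  by move=> cf cg x Ax; apply: continuousD; [exact: cf|exact: cg].
case=> df Df [dg Dg]; split=> [x Ax|v].
  by apply: differentiableD; [exact: df|exact: dg].
apply: eq_Ck oA _ (IH _ _ (Df v) (Dg v)) => x; rewrite inE => Ax.
by rewrite deriveD//; apply: diff_derivable; [exact: df|exact: dg].
Qed.

End CkBasic.

Section CkScalar.
Context {V : normedModType R}.
Implicit Types (A : set V) (f g : V -> R).

Lemma CkM k A f g : open A -> Ck k A f -> Ck k A g -> Ck k A (fun x => f x * g x).
Proof.
move=> oA; elim: k f g => [|k IH] f g.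
  by move=> cf cg x Ax; apply: continuousM; [exact: cf|exact: cg].
move=> Cf Cg; have [df Df] := Cf; have [dg Dg] := Cg; split=> [x Ax|v].
  by apply: differentiableM; [exact: df|exact: dg].
have Cf' := Ck_pred Cf; have Cg' := Ck_pred Cg.
apply: eq_Ck oA _ (CkD oA (IH _ _ Cf' (Dg v)) (IH _ _ Cg' (Df v))) => x.
rewrite inE => Ax.
by rewrite deriveM//; apply: diff_derivable; [exact: df|exact: dg].
Qed.

Lemma Ck_sum k A (I : Type) (r : seq I) (F : I -> V -> R) : open A ->
  (forall i, Ck k A (F i)) -> Ck k A (fun x => \sum_(i <- r) F i x).
Proof.
move=> oA CF; elim: r => [|i r IH].
  by rewrite (_ : (fun _ => _) = (fun _ => 0));
    [exact: Ck_cst|apply/funext => x; rewrite big_nil].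
rewrite (_ : (fun _ => _) = (fun x => F i x + \sum_(j <- r) F j x)).
  exact: CkD.
by apply/funext => x; rewrite big_cons.
Qed.

Lemma Ck_coord k A (d : nat) (f : V -> 'rV[R]_d) (j : 'I_d) : open A ->
  Ck k A f -> Ck k A (fun x => f x 0 j : R).
Proof.
move=> oA; elim: k f => [|k IH] f.
  move=> cf x Ax.
  apply: (@continuous_comp _ _ _ f (fun N : 'rV[R]_d => N 0 j)); first exact: cf.
  exact: coord_continuous.
case=> df Df; split=> [x Ax|v]; first exact/differentiable_coordf/df.
apply: eq_Ck oA _ (IH _ (Df v)) => x; rewrite inE => Ax.
by rewrite derive_coord//; exact: df.
Qed.

End CkScalar.

Lemma derive_sumE (d : nat) (f : 'rV[R]_d -> R) (x v : 'rV[R]_d) :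
  differentiable f x -> 'D_v f x = \sum_j v 0 j * 'D_(delta_mx 0 j) f x.
Proof.
move=> df; rewrite deriveE// {1}(row_sum_delta v) linear_sum.
by apply: eq_bigr => j _; rewrite linearZ deriveE.
Qed.

Lemma derive_comp (V V' W : normedModType R) (f : V' -> W) (g : V -> V') x v :
  differentiable g x -> differentiable f (g x) ->
  'D_v (f \o g) x = 'D_('D_v g x) f (g x).
Proof.
move=> dg df; rewrite deriveE; last exact: differentiable_comp.
by rewrite diff_comp//= !deriveE.
Qed.

(** The chain rule differentiates f in the direction 'D_v g x, which moves with x, whereas [Ck]
    controls derivatives in fixed directions. Expanding that direction in the standard basis gives a
    sum of products to which the induction hypothesis and [CkM] apply. *)
Lemma Ck_comp (V : normedModType R) k (d : nat) (A : set V) (B : set 'rV[R]_d)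
    (f : 'rV[R]_d -> R) (g : V -> 'rV[R]_d) : open A ->
  (forall x, A x -> B (g x)) -> Ck k A g -> Ck k B f -> Ck k A (f \o g).
Proof.
move=> oA AB; elim: k f => [|k IH] f.
  by move=> cg cf x Ax; apply: continuous_comp; [exact: cg|apply: cf; exact: AB].
move=> Cg Cf; have [dg Dg] := Cg; have [df Df] := Cf; split=> [x Ax|v].
  by apply: differentiable_comp; [exact: dg|exact/df/AB].
have C1 (j : 'I_d) : Ck k A (fun x =>
    ('D_v g x) 0 j * (('D_(delta_mx 0 j) f) \o g) x).
  apply: CkM => //; first exact: (Ck_coord j oA (Dg v)).
  by apply: IH; [exact: (Ck_pred Cg)|exact: Df].
apply: eq_Ck oA _ (Ck_sum (index_enum 'I_d) oA C1) => x; rewrite inE => Ax.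
have dfg : differentiable f (g x) by exact/df/AB.
by rewrite [RHS](derive_comp v (dg _ Ax) dfg) derive_sumE.
Qed.

End SmoothCalculus.

(** * Symmetry of mixed directional derivatives *)

Section Schwarz.
Context {R : realType} {V : normedModType R}.
Implicit Types (f : V -> R) (A : set V).

Lemma is_derive_line f (y v : V) (s : R) : differentiable f (y + s *: v) ->
  is_derive s (1 : R) (fun t : R => f (y + t *: v)) ('D_v f (y + s *: v)).
Proof.
move=> df; pose g (t : R) : V := y + t *: v.
have dg : is_diff s g (0 + ( *:%R^~ v)) by apply: is_diffD.
have dgs : differentiable g s by exact: ex_diff.
split; first exact/diff_derivable/(differentiable_comp dgs df).
rewrite (derive_comp (f := f) (1 : R) dgs df); congr ('D__ f _).
by rewrite deriveE// diff_val -[LHS]/(0 + 1 *: v) scale1r add0r.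
Qed.

(** Mean value theorem twice: for [phi] along v, then for [psi], a restriction of 'D_v f, along w.
    The left side is symmetric in v and w up to rearrangement, which is what yields the symmetry of
    the mixed derivatives. *)
Lemma second_difference A f (x v w : V) (h : R) : 0 < h ->
  (forall y, A y -> differentiable f y) ->
  (forall y, A y -> differentiable ('D_v f) y) ->
  (forall s t, 0 <= s <= h -> 0 <= t <= h -> A (x + s *: v + t *: w)) ->
  exists s t, [/\ 0 <= s <= h, 0 <= t <= h &
    f (x + h *: v + h *: w) - f (x + h *: v) - (f (x + h *: w) - f x) =
    'D_w ('D_v f) (x + s *: v + t *: w) * h * h].
Proof.
move=> h0 df ddf Ah.
have h00 : 0 <= (0 : R) <= h by rewrite lexx ltW.
have hhh : 0 <= h <= h by rewrite lexx ltW.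
pose phi (s : R) := f ((x + h *: w) + s *: v) - f (x + s *: v).
have dphi (s : R) : 0 <= s <= h ->
    is_derive s 1 phi ('D_v f ((x + h *: w) + s *: v) - 'D_v f (x + s *: v)).
  move=> sh; apply: is_deriveB.
    by apply/is_derive_line/df; rewrite addrAC; exact: Ah.
  by apply/is_derive_line/df; have := Ah s 0 sh h00; rewrite scale0r addr0.
have itvW (s : R) : s \in `[0, h] -> 0 <= s <= h by rewrite in_itv.
have itvoW (s : R) : s \in `]0, h[ -> 0 <= s <= h.
  by rewrite in_itv /= => /andP[/ltW -> /ltW ->].
have cphi : {within `[0, h], continuous phi}.
  apply: derivable_within_continuous => s /itvW sh.
  by have [] := dphi s sh.
have [s sh phiE] := MVT h0 (fun s sh => dphi s (itvoW s sh)) cphi.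
have {}sh := itvoW _ sh.
pose psi (t : R) := 'D_v f ((x + s *: v) + t *: w).
have dpsi (t : R) : 0 <= t <= h ->
    is_derive t 1 psi ('D_w ('D_v f) ((x + s *: v) + t *: w)).
  by move=> th; apply/is_derive_line/ddf/Ah.
have cpsi : {within `[0, h], continuous psi}.
  apply: derivable_within_continuous => t /itvW th.
  by have [] := dpsi t th.
have [t th psiE] := MVT h0 (fun s sh => dpsi s (itvoW s sh)) cpsi.
exists s, t; split => //; first exact: itvoW.
move: phiE psiE; rewrite /phi /psi !scale0r !addr0 !subr0.
rewrite (addrAC x (h *: w) (h *: v)) (addrAC x (h *: w) (s *: v)) => -> ->.
by rewrite mulrAC.
Qed.

Lemma near_continuous2 (F G : V -> R) A (x : V) (e : R) : nbhs x A ->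
  {for x, continuous F} -> {for x, continuous G} -> 0 < e ->
  \forall y \near x, [/\ A y, `|F x - F y| < e & `|G x - G y| < e].
Proof.
move=> nA /cvgrPdist_lt cF /cvgrPdist_lt cG e0; near=> y.
by split; near: y; [exact: nA|exact: cF|exact: cG].
Unshelve. all: by end_near. Qed.

Lemma close_le (a b c c' e : R) : c' = c -> `|a - c| < e / 2 ->
  `|b - c'| < e / 2 -> a <= b + e.
Proof.
by move=> ->; rewrite !ltr_norml => /andP[? ?] /andP[? ?]; lra.
Qed.

Lemma schwarz A f (x v w : V) : open A -> A x -> Ck 2 A f ->
  'D_v ('D_w f) x = 'D_w ('D_v f) x.
Proof.
move=> oA Ax [df Df].
have cF u u' : {for x, continuous ('D_u ('D_u' f))}.
  by have [_ /(_ u)] := Df u'; apply.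
have ddf u y : A y -> differentiable ('D_u f) y by have [/(_ y)] := Df u.
apply/eqP; rewrite eq_le; apply/andP.
(* One inequality for all pairs is enough, since u and u' can be exchanged. *)
suff key u u' : 'D_u ('D_u' f) x <= 'D_u' ('D_u f) x by split; exact: key.
apply/ler_addgt0Pr => e e0.
have e2 : 0 < e / 2 by rewrite divr_gt0.
have N : \forall y \near x, [/\ A y, `|'D_u ('D_u' f) x - 'D_u ('D_u' f) y| < e / 2
     & `|'D_u' ('D_u f) x - 'D_u' ('D_u f) y| < e / 2].
  by apply: near_continuous2 => //; exact: open_nbhs_nbhs.
have [r /= r0 Nr] := (nbhs_normP _ _).1 N.
(* The parallelogram with sides h u and h u' has to stay in the ball of radius r where both mixed
   derivatives are within e / 2 of their value at x. The summand 1 keeps [m] positive when u and u'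
   vanish. *)
pose m := `|u| + `|u'| + 1.
have m0 : 0 < m by rewrite ltr_wpDl// addr_ge0.
pose h := r / 2 / m.
have h0 : 0 < h by rewrite !divr_gt0.
have hm : h * (`|u| + `|u'|) < r.
  rewrite (@lt_trans _ _ (h * m))//; first by rewrite ltr_pM2l// ltrDl.
  by rewrite /h divfK ?gt_eqF// gtr_pMr// invf_lt1// ltr1n.
have near_r s t : 0 <= s <= h -> 0 <= t <= h ->
    [/\ A (x + s *: u + t *: u'), 
     `|'D_u ('D_u' f) x - 'D_u ('D_u' f) (x + s *: u + t *: u')| < e / 2
     & `|'D_u' ('D_u f) x - 'D_u' ('D_u f) (x + s *: u + t *: u')| < e / 2].
  move=> /andP[s0 sh] /andP[t0 th]; apply: Nr => /=.
  rewrite -addrA opprD addNKr normrN (le_lt_trans _ hm)//.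
  rewrite (le_trans (ler_normD _ _))// !normrZ !ger0_norm// mulrDr.
  by rewrite lerD// ler_wpM2r.
have [s [t [sh th E1]]] := second_difference (A := A) (x := x) (v := u)
  (w := u') h0 df (ddf u)
   (fun s t sh th => let: And3 a _ _ := near_r s t sh th in a).
have [t' [s' [th' sh' E2]]] : exists s t, [/\ 0 <= s <= h, 0 <= t <= h &
    f (x + h *: u' + h *: u) - f (x + h *: u') - (f (x + h *: u) - f x) =
    'D_u ('D_u' f) (x + s *: u' + t *: u) * h * h].
  apply: (second_difference (A := A)) => // [y|s2 t2 sh2 th2].
    exact: ddf.
  by rewrite addrAC; have [] := near_r _ _ th2 sh2.
(* Both mixed derivatives, each at its own intermediate point, are the same second difference
   divided by h^2. *)
have E : 'D_u' ('D_u f) (x + s *: u + t *: u') =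
         'D_u ('D_u' f) (x + s' *: u + t' *: u').
  have hh : h * h != 0 by rewrite mulf_neq0 ?gt_eqF.
  rewrite (addrAC x (s' *: u)); apply: (mulIf hh).
  rewrite [LHS]mulrA [RHS]mulrA; apply: (etrans (esym E1)); apply: etrans E2.
  rewrite (addrAC x (h *: u)); move: (f _) (f (x + h *: u)) (f (x + h *: u')).
  by move=> a1 a2 a3; ring.
have [_ _ B1] := near_r _ _ sh th.
have [_ B2 _] := near_r _ _ sh' th'.
exact: (close_le E B2 B1).
Qed.

End Schwarz.

(** * Rules for maps known to be linear through a proposition only, such as
    [fun v => nabla p v Y] *)

Section LinearFun.
Context {R : pzRingType} {V W : lmodType R} {f : V -> W}.
Hypothesis lf : linear f.

Lemma linear_funD x y : f (x + y) = f x + f y.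
Proof. by have := lf 1 x y; rewrite !scale1r. Qed.

Lemma linear_fun0 : f 0 = 0.
Proof. by apply: (@addrI _ (f 0)); rewrite -linear_funD !addr0. Qed.

Lemma linear_funZ a x : f (a *: x) = a *: f x.
Proof. by have := lf a x 0; rewrite linear_fun0 !addr0. Qed.

Lemma linear_funN x : f (- x) = - f x.
Proof. by rewrite -scaleN1r linear_funZ scaleN1r. Qed.

Lemma linear_funB x y : f (x - y) = f x - f y.
Proof. by rewrite linear_funD linear_funN. Qed.

Lemma linear_fun_sum (I : Type) (r : seq I) (a : I -> R) (x : I -> V) :
  f (\sum_(i <- r) a i *: x i) = \sum_(i <- r) a i *: f (x i).
Proof.
elim: r => [|i r IH]; first by rewrite !big_nil linear_fun0.
by rewrite !big_cons linear_funD linear_funZ IH.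
Qed.

End LinearFun.

(** * Calculus in charts *)

Section ManifoldCalculus.
Context {R : realType} {d : nat} {M : orientedManifold R d}.
Implicit Types (c : chart R d M) (U V : set M) (p q : M) (f g : M -> R)
  (v w : 'rV[R]_d) (X Y Z : vfield M).

Lemma chart_imgE c U x : (c @` (chart_dom c `&` U)) x ->
  [/\ chart_dom c (chart_inv c x), U (chart_inv c x) & c (chart_inv c x) = x].
Proof. by case=> q [cq Uq] <-; rewrite chart_mapK. Qed.

Lemma chart_img c U q : chart_dom c q -> U q -> (c @` (chart_dom c `&` U)) (c q).
Proof. by move=> cq Uq; exists q. Qed.

Lemma chart_img_openI c U : open U -> open (c @` (chart_dom c `&` U)).
Proof.
move=> oU; rewrite openE => _ [q [cq Uq] <-]; rewrite /interior.
have icq : (c @` chart_dom c) (c q) by exists q.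
have nU : nbhs (chart_inv c (c q)) U.
  by rewrite chart_mapK//; exact: open_nbhs_nbhs.
have n1 := @chart_inv_continuous _ _ _ c _ icq U nU.
have n2 : nbhs (c q) (c @` chart_dom c).
  by apply: open_nbhs_nbhs; split => //; exact: chart_img_open.
near=> y.
have [r cr ry] : (c @` chart_dom c) y by near: y.
have Uy : U (chart_inv c y) by near: y.
by exists r => //; split => //; rewrite -(chart_mapK cr) ry.
Unshelve. all: by end_near. Qed.

Arguments chart_img_openI c [U] _.

Lemma near_chart c U q : open U -> chart_dom c q -> U q ->
  \forall x \near c q, [/\ chart_dom c (chart_inv c x), U (chart_inv c x) &
    c (chart_inv c x) = x].
Proof.
move=> oU cq Uq.
have : nbhs (c q) (c @` (chart_dom c `&` U)).
  by apply: open_nbhs_nbhs; split; [exact: chart_img_openI|exact: chart_img].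
by apply: filterS => x; exact: chart_imgE.
Qed.

Lemma eq_smooth_on U f g : open U -> (forall q, U q -> f q = g q) ->
  smooth_on U f -> smooth_on U g.
Proof.
move=> oU fg sf c ac k.
apply: eq_Ck (chart_img_openI c oU) _ (sf c ac k) => x; rewrite inE.
by move=> /chart_imgE[_ Ux _] /=; exact: fg.
Qed.

Lemma sub_smooth_on U V f : U `<=` V -> smooth_on V f -> smooth_on U f.
Proof.
move=> UV sf c ac k; apply: sub_Ck (sf c ac k) => _ [q [cq Uq] <-].
by exists q => //; split => //; exact: UV.
Qed.

Lemma smooth_on_cst U (a : R) : smooth_on U (fun _ => a).
Proof. by move=> c ac k; exact: Ck_cst. Qed.

Lemma smooth_onD U f g : open U -> smooth_on U f -> smooth_on U g ->
  smooth_on U (fun q => f q + g q).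
Proof.
move=> oU sf sg c ac k.
exact: (CkD (chart_img_openI c oU) (sf c ac k) (sg c ac k)).
Qed.

Lemma smooth_onM U f g : open U -> smooth_on U f -> smooth_on U g ->
  smooth_on U (fun q => f q * g q).
Proof.
move=> oU sf sg c ac k.
exact: (CkM (chart_img_openI c oU) (sf c ac k) (sg c ac k)).
Qed.

Lemma smooth_onZ U (a : R) f : open U -> smooth_on U f ->
  smooth_on U (fun q => a * f q).
Proof. by move=> oU sf; apply: smooth_onM => //; exact: smooth_on_cst. Qed.

Lemma smooth_onB U f g : open U -> smooth_on U f -> smooth_on U g ->
  smooth_on U (fun q => f q - g q).
Proof.
move=> oU sf sg; apply: (@eq_smooth_on U (fun q => f q + -1 * g q)) => //.
  by move=> q _; rewrite mulN1r.
by apply: smooth_onD => //; exact: smooth_onZ.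
Qed.

Lemma smooth_on_sum U (I : Type) (r : seq I) (F : I -> M -> R) : open U ->
  (forall i, smooth_on U (F i)) -> smooth_on U (fun q => \sum_(i <- r) F i q).
Proof.
move=> oU sF c ac k.
exact: (Ck_sum r (chart_img_openI c oU) (fun i => sF i c ac k)).
Qed.

Lemma smooth_on_charts U f :
  (forall c, atlas c -> smooth_on (U `&` chart_dom c) f) -> smooth_on U f.
Proof.
move=> sf c ac k; apply: sub_Ck (sf c ac c ac k) => _ [q [cq Uq] <-].
by exists q.
Qed.

(** Seen from another chart, the function is h composed with a transition map. It is used for the
    partial derivatives of a function in the chart c. *)
Lemma smooth_on_pull c U (h : 'rV[R]_d -> R) : open U -> atlas c ->
  smooth (c @` (chart_dom c `&` U)) h ->
  smooth_on (U `&` chart_dom c) (fun q => h (c q)).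
Proof.
move=> oU ac sh c' ac' k.
have oUc : open (U `&` chart_dom c) by apply: openI => //; exact: chart_dom_open.
apply: (@Ck_comp _ _ k d _ _ h (c \o chart_inv c') _ _ _ (sh k)).
- exact: chart_img_openI.
- move=> _ [q [c'q [Uq cq]] <-]; rewrite /= chart_mapK//; exact: chart_img.
- apply: sub_Ck (transition_smooth ac' ac k) => _ [q [c'q [Uq cq]] <-].
  exact: chart_img.
Qed.

Lemma smooth_on_coord c j : atlas c -> smooth_on (chart_dom c) (coord c j).
Proof.
move=> ac c' ac' k.
apply: (Ck_coord j (chart_img_openI c' (chart_dom_open c))).
exact: transition_smooth.
Qed.

Lemma smooth_on_diff c U f q : smooth_on U f -> atlas c -> chart_dom c q -> U q ->
  differentiable (f \o chart_inv c) (c q).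
Proof. by move=> sf ac cq Uq; have [df _] := sf c ac 1%N; exact/df/chart_img. Qed.

Lemma transition_diff c c' q : atlas c -> atlas c' -> chart_dom c q ->
  chart_dom c' q -> differentiable (c' \o chart_inv c) (c q).
Proof.
move=> ac ac' cq c'q; have [df _] := transition_smooth ac ac' 1%N.
exact/df/chart_img.
Qed.

Lemma derive_chart c c' q f v : atlas c -> atlas c' -> chart_dom c q ->
  chart_dom c' q -> differentiable (f \o chart_inv c') (c' q) ->
  'D_v (f \o chart_inv c) (c q) =
  'D_('D_v (c' \o chart_inv c) (c q)) (f \o chart_inv c') (c' q).
Proof.
move=> ac ac' cq c'q df.
have E : (c' \o chart_inv c) (c q) = c' q by rewrite /= chart_mapK.
transitivity ('D_v ((f \o chart_inv c') \o (c' \o chart_inv c)) (c q)).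
  apply: near_eq_derive; near=> x.
  have [_ cx _] : [/\ chart_dom c (chart_inv c x),
    chart_dom c' (chart_inv c x) & c (chart_inv c x) = x].
    by near: x; apply: near_chart => //; exact: chart_dom_open.
  by rewrite /= chart_mapK.
rewrite derive_comp ?E//.
exact: transition_diff.
Unshelve. all: by end_near. Qed.

Lemma eq_dirder U f g q v : open U -> U q -> (forall r, U r -> f r = g r) ->
  dirder f q v = dirder g q v.
Proof.
move=> oU Uq fg; apply: near_eq_derive; near=> x.
have [_ Ux _] : [/\ chart_dom (chart_at q) (chart_inv (chart_at q) x),
    U (chart_inv (chart_at q) x) & chart_at q (chart_inv (chart_at q) x) = x].
  by near: x; apply: near_chart => //; exact: chart_at_dom.
exact: fg.
Unshelve. all: by end_near. Qed.

Lemma dirder_diff U f q : smooth_on U f -> U q ->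
  differentiable (f \o chart_inv (chart_at q)) (chart_at q q).
Proof.
by move=> sf Uq; apply: smooth_on_diff sf _ _ Uq;
  [exact: chart_at_atlas|exact: chart_at_dom].
Qed.

Lemma dirder_linear U f q : smooth_on U f -> U q ->
  linear (dirder f q : 'rV[R]_d -> R^o).
Proof.
move=> sf Uq a v w; have df := dirder_diff sf Uq.
by rewrite /dirder !deriveE// linearP.
Qed.

Lemma dirderDv U f q v w : smooth_on U f -> U q ->
  dirder f q (v + w) = dirder f q v + dirder f q w.
Proof. by move=> sf Uq; have := dirder_linear sf Uq 1 v w; rewrite !scale1r. Qed.

Lemma dirder0v U f q : smooth_on U f -> U q -> dirder f q 0 = 0.
Proof.
move=> sf Uq; have := dirderDv 0 0 sf Uq; rewrite addr0.
by move=> /eqP; rewrite -subr_eq subrr => /eqP.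
Qed.

Lemma dirderZv U f q a v : smooth_on U f -> U q ->
  dirder f q (a *: v) = a * dirder f q v.
Proof.
move=> sf Uq; have := dirder_linear sf Uq a v 0.
by rewrite (dirder0v sf Uq) !addr0.
Qed.

Lemma dirder_cst (a : R) q v : dirder (fun _ => a) q v = 0.
Proof. by rewrite /dirder; exact: derive_cst. Qed.

Lemma dirderD U f g q v : smooth_on U f -> smooth_on U g -> U q ->
  dirder (fun r => f r + g r) q v = dirder f q v + dirder g q v.
Proof.
move=> sf sg Uq; apply: deriveD; apply: diff_derivable;
  [exact: dirder_diff sf Uq|exact: dirder_diff sg Uq].
Qed.

Lemma dirderM U f g q v : smooth_on U f -> smooth_on U g -> U q ->
  dirder (fun r => f r * g r) q v = f q * dirder g q v + g q * dirder f q v.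
Proof.
move=> sf sg Uq; rewrite /dirder.
have df := dirder_diff sf Uq; have dg := dirder_diff sg Uq.
rewrite [LHS](deriveM (diff_derivable df) (diff_derivable dg)) /=.
by rewrite chart_mapK//; exact: chart_at_dom.
Qed.

Lemma dirderZ U a g q v : smooth_on U g -> U q ->
  dirder (fun r => a * g r) q v = a * dirder g q v.
Proof.
move=> sg Uq; rewrite (dirderM _ (smooth_on_cst U a) sg Uq).
by rewrite dirder_cst mulr0 addr0.
Qed.

Lemma dirder_sum U (I : Type) (r : seq I) (F : I -> M -> R) q v : open U ->
  (forall i, smooth_on U (F i)) -> U q ->
  dirder (fun x => \sum_(i <- r) F i x) q v = \sum_(i <- r) dirder (F i) q v.
Proof.
move=> oU sF Uq; elim: r => [|i r IH].
  rewrite big_nil (@eq_dirder U _ (fun=> 0))// ?dirder_cst// => x _.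
  by rewrite big_nil.
rewrite big_cons -IH -(dirderD _ (sF i) (smooth_on_sum r oU sF) Uq).
by apply: (eq_dirder _ oU Uq) => x _; rewrite big_cons.
Qed.

Lemma dirder_sumv U f q (I : Type) (r : seq I) (a : I -> R) (v : I -> 'rV[R]_d) :
  smooth_on U f -> U q ->
  dirder f q (\sum_(i <- r) a i *: v i) = \sum_(i <- r) a i * dirder f q (v i).
Proof.
move=> sf Uq; elim: r => [|i r IH]; first by rewrite !big_nil (dirder0v sf Uq).
by rewrite !big_cons (dirderDv _ _ sf Uq) (dirderZv _ _ sf Uq) IH.
Qed.

(** Vectors at q are stored by their components in the preferred chart, whose coordinates are the
    identity there. Vector identities at q can therefore be tested on these coordinate functions. *)
Lemma dirder_coord_at q i v : dirder (coord (chart_at q) i) q v = v 0 i.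
Proof.
rewrite /dirder; have cq : chart_dom (chart_at q) q by exact: chart_at_dom.
transitivity ('D_v (fun x : 'rV[R]_d => x 0 i) (chart_at q q)).
  apply: near_eq_derive; near=> x.
  have [_ _ E] : [/\ chart_dom (chart_at q) (chart_inv (chart_at q) x),
     setT (chart_inv (chart_at q) x) & chart_at q (chart_inv (chart_at q) x) = x].
    by near: x; apply: near_chart => //; exact: openT.
  by rewrite /= /coord E.
have := @derive_coord R 'rV[R]_d d id (chart_at q q) v i.
by rewrite derive_id => <-//.
Unshelve. all: by end_near. Qed.

(** The chain rule through the transition from the preferred chart to c. It separates the components
    v(x^j), whose smoothness defines smooth fields, from the partial derivatives of f. *)
Lemma dirder_chart c U f q v : atlas c -> chart_dom c q -> smooth_on U f -> U q ->
  dirder f q v =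
  \sum_j dirder (coord c j) q v * 'D_(delta_mx 0 j) (f \o chart_inv c) (c q).
Proof.
move=> ac cq sf Uq.
have aq := chart_at_atlas q; have qq := chart_at_dom q.
have df := smooth_on_diff sf ac cq Uq.
rewrite {1}/dirder (derive_chart (c' := c))// derive_sumE//.
apply: eq_bigr => j _; congr (_ * _); rewrite derive_coord//.
exact: transition_diff.
Qed.

Lemma dirder_chart_vf c U f q w : atlas c -> chart_dom c q -> smooth_on U f ->
  U q -> dirder f q (chart_vf c w q) = 'D_w (f \o chart_inv c) (c q).
Proof.
move=> ac cq sf Uq; have aq := chart_at_atlas q; have qq := chart_at_dom q.
have df := smooth_on_diff sf aq qq Uq.
by rewrite [RHS](derive_chart (c' := chart_at q)).
Qed.

Lemma chart_vf_linear c q : atlas c -> chart_dom c q ->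
  linear (fun w => chart_vf c w q).
Proof.
move=> ac cq a v w.
have df : differentiable (chart_at q \o chart_inv c) (c q).
  by apply: transition_diff => //; [exact: chart_at_atlas|exact: chart_at_dom].
by rewrite /chart_vf !deriveE// linearP.
Qed.

Lemma chart_vf_expansion c q v : atlas c -> chart_dom c q ->
  v = \sum_j dirder (coord c j) q v *: chart_vf c (delta_mx 0 j) q.
Proof.
move=> ac cq; apply/rowP => i; have aq := chart_at_atlas q.
have qq := chart_at_dom q; have sc := smooth_on_coord i aq.
rewrite summxE -[LHS](dirder_coord_at q) (dirder_chart v ac cq sc qq).
apply: eq_bigr => j _; rewrite mxE; congr (_ * _).
rewrite -[RHS](dirder_coord_at q).
by rewrite (dirder_chart_vf _ ac cq sc qq).
Qed.

Lemma smooth_vder U X f : open U -> smooth_vf U X -> smooth_on U f ->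
  smooth_on U (vder X f).
Proof.
move=> oU sX sf c ac k; have oA := chart_img_openI c oU.
have C1 (j : 'I_d) : Ck k (c @` (chart_dom c `&` U)) (fun x =>
    vder X (coord c j) (chart_inv c x) * 'D_(delta_mx 0 j) (f \o chart_inv c) x).
  apply: CkM => //.
    apply: sub_Ck (sX c j ac c ac k) => _ [q [cq Uq] <-].
    exact: chart_img.
  by have [_] := sf c ac k.+1; apply.
apply: eq_Ck oA _ (Ck_sum (index_enum 'I_d) oA C1) => x; rewrite inE.
case=> q [cq Uq] <-; rewrite /= chart_mapK//.
by rewrite /vder (dirder_chart _ ac cq sf Uq).
Qed.

Lemma sub_smooth_vf U V X : U `<=` V -> smooth_vf V X -> smooth_vf U X.
Proof.
move=> UV sX c j ac; apply: sub_smooth_on (sX c j ac).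
by move=> q [/UV].
Qed.

Let openUc U c : open U -> open (U `&` chart_dom c).
Proof. by move=> oU; apply: openI => //; exact: chart_dom_open. Qed.

Lemma eq_smooth_vf U X Y : open U -> (forall q, U q -> X q = Y q) ->
  smooth_vf U X -> smooth_vf U Y.
Proof.
move=> oU XY sX c j ac; apply: eq_smooth_on (sX c j ac); first exact: openUc.
by move=> q [Uq _]; rewrite /vder XY.
Qed.

Lemma smooth_vfD U X Y : open U -> smooth_vf U X -> smooth_vf U Y ->
  smooth_vf U (fun q => X q + Y q).
Proof.
move=> oU sX sY c j ac.
apply: (eq_smooth_on (openUc c oU) _ (smooth_onD (openUc c oU) (sX c j ac) (sY c j ac))).
by move=> q [Uq cq]; rewrite /vder (dirderDv _ _ (smooth_on_coord j ac)).
Qed.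

Lemma smooth_vfZ U f X : open U -> smooth_on U f -> smooth_vf U X ->
  smooth_vf U (fun q => f q *: X q).
Proof.
move=> oU sf sX c j ac.
have sf' : smooth_on (U `&` chart_dom c) f by apply: sub_smooth_on sf => q [].
apply: (eq_smooth_on (openUc c oU) _ (smooth_onM (openUc c oU) sf' (sX c j ac))).
by move=> q [Uq cq]; rewrite /vder (dirderZv _ _ (smooth_on_coord j ac)).
Qed.

Lemma smooth_vf0 U : smooth_vf U (fun _ => 0).
Proof.
move=> c j ac c' ac' k; have oA := chart_img_openI c' (chart_dom_open c).
apply: (@sub_Ck _ _ _ _ _ (c' @` (chart_dom c' `&` chart_dom c))).
  by move=> _ [q [cq [Uq c'q]] <-]; exact: chart_img.
apply: eq_Ck oA _ (Ck_cst k _ 0) => x; rewrite inE => /chart_imgE[_ cx _].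
by rewrite /= /vder (dirder0v (smooth_on_coord j ac)).
Qed.

Lemma smooth_vf_sum U (I : Type) (r : seq I) (a : I -> M -> R) (X : I -> vfield M) :
  open U -> (forall i, smooth_on U (a i)) -> (forall i, smooth_vf U (X i)) ->
  smooth_vf U (fun q => \sum_(i <- r) a i q *: X i q).
Proof.
move=> oU sa sX; elim: r => [|i r IH].
  by apply: eq_smooth_vf oU _ (smooth_vf0 U) => q _; rewrite big_nil.
apply: eq_smooth_vf oU _ (smooth_vfD oU (smooth_vfZ oU (sa i) (sX i)) IH) => q _.
by rewrite big_cons.
Qed.

Lemma smooth_vfB U X Y : open U -> smooth_vf U X -> smooth_vf U Y ->
  smooth_vf U (fun q => X q - Y q).
Proof.
move=> oU sX sY.
have := smooth_vfD oU sX (smooth_vfZ oU (smooth_on_cst U (-1)) sY).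
by apply: eq_smooth_vf => // q _; rewrite scaleN1r.
Qed.

Lemma smooth_chart_vf c v : atlas c -> smooth_vf (chart_dom c) (chart_vf c v).
Proof.
move=> ac c' j ac'.
have oc := chart_dom_open c; have oc' := chart_dom_open c'.
have sh : smooth (c @` (chart_dom c `&` chart_dom c'))
    ('D_v (coord c' j \o chart_inv c)).
  by move=> k; have [_] := smooth_on_coord j ac' ac k.+1; apply.
have := smooth_on_pull oc' ac sh; rewrite setIC.
apply: eq_smooth_on; first exact: openI.
move=> q [cq c'q].
by rewrite /vder (dirder_chart_vf v ac cq (smooth_on_coord j ac') c'q).
Qed.

Lemma smooth_extend p v : smooth_vf (chart_dom (chart_at p)) (extend p v).
Proof. exact/smooth_chart_vf/chart_at_atlas. Qed.

(** [lie] is defined by the commutator on the coordinates of one chart; this extends it to every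
    smooth function. After expansion in that chart the second derivatives [H i j] of f enter both
    XYf and YXf, and they cancel by [schwarz]. *)
Lemma vder_lie U X Y f q : open U -> U q -> smooth_vf U X -> smooth_vf U Y ->
  smooth_on U f ->
  dirder f q (lie X Y q) = vder X (vder Y f) q - vder Y (vder X f) q.
Proof.
move=> oU Uq sX sY sf; pose c := chart_at q.
have ac : atlas c by exact: chart_at_atlas.
have cq : chart_dom c q by exact: chart_at_dom.
pose V := U `&` chart_dom c.
have oV : open V by exact: openUc.
have Vq : V q by [].
pose fd j := 'D_(delta_mx 0 j) (f \o chart_inv c).
have sfd j : smooth_on V (fun r => fd j (c r)).
  by apply: smooth_on_pull => // k; have [_] := sf c ac k.+1; apply.
pose H i j := 'D_(delta_mx 0 i) (fd j) (c q).
have Hsym i j : H i j = H j i.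
  apply: (@schwarz _ _ (c @` (chart_dom c `&` U))).
  - exact: chart_img_openI.
  - exact: chart_img.
  - exact: sf.
have dfd Z j : dirder (fun r => fd j (c r)) q (Z q) =
    \sum_i dirder (coord c i) q (Z q) * H i j.
  rewrite (dirder_chart _ ac cq (sfd j) Vq).
  apply: eq_bigr => i _; apply: (f_equal (fun x => dirder (coord c i) q (Z q) * x)).
  apply: near_eq_derive.
  near=> x.
  suff: c (chart_inv c x) = x by move=> /= ->.
  have [_ _ //] : [/\ chart_dom c (chart_inv c x), setT (chart_inv c x) &
     c (chart_inv c x) = x].
  by near: x; apply: near_chart => //; exact: openT.
have E Z (W : vfield M) : smooth_vf U Z -> smooth_vf U W ->
    vder Z (vder W f) q =
    (\sum_j \sum_i dirder (coord c j) q (W q) * (dirder (coord c i) q (Z q) * H i j))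
    + \sum_j fd j (c q) * vder Z (vder W (coord c j)) q.
  move=> sZ sW; have sWc j : smooth_on V (vder W (coord c j)) by exact: sW.
  have sm j : smooth_on V (fun r => vder W (coord c j) r * fd j (c r)).
    exact: smooth_onM.
  rewrite -big_split /=.
  transitivity (dirder (fun r => \sum_j vder W (coord c j) r * fd j (c r)) q (Z q)).
    apply: (eq_dirder _ oV Vq) => r [Ur cr].
    exact: (dirder_chart _ ac cr sf Ur).
  rewrite (dirder_sum _ _ oV)//; apply: eq_bigr => j _.
  by rewrite (dirderM _ (sWc j) (sfd j) Vq) dfd mulr_sumr.
have E1 := E _ _ sX sY; have E2 := E _ _ sY sX.
have sym (a b : 'I_d -> R) : \sum_j \sum_i a j * (b i * H i j) =
    \sum_j \sum_i b j * (a i * H i j).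
  rewrite exchange_big; apply: eq_bigr => i _; apply: eq_bigr => j _.
  by rewrite mulrCA Hsym.
have F : dirder f q (lie X Y q) = \sum_j fd j (c q) *
    (vder X (vder Y (coord c j)) q - vder Y (vder X (coord c j)) q).
  rewrite (dirder_chart _ ac cq sf Uq); apply: eq_bigr => j _.
  by rewrite dirder_coord_at mxE mulrC.
rewrite F; move: E1 E2.
move: (vder X (vder Y f) q) (vder Y (vder X f) q) => a b -> ->.
rewrite [in X in _ - X]sym opprD addrACA subrr add0r -sumrB.
by apply: eq_bigr => j _; rewrite mulrBr.
Unshelve. all: by end_near. Qed.

Lemma smooth_lie U X Y : open U -> smooth_vf U X -> smooth_vf U Y ->
  smooth_vf U (lie X Y).
Proof.
move=> oU sX sY c j ac; have oUc := openUc c oU.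
have sX' : smooth_vf (U `&` chart_dom c) X by apply: sub_smooth_vf sX => q [].
have sY' : smooth_vf (U `&` chart_dom c) Y by apply: sub_smooth_vf sY => q [].
have sc : smooth_on (U `&` chart_dom c) (coord c j).
  by apply: sub_smooth_on (smooth_on_coord j ac) => q [].
have := smooth_onB oUc (smooth_vder oUc sX' (smooth_vder oUc sY' sc))
  (smooth_vder oUc sY' (smooth_vder oUc sX' sc)).
apply: eq_smooth_on => // q Uq.
exact/esym/(vder_lie oUc Uq sX' sY' sc).
Qed.

(** * Additivity and Leibniz rules of the Lie bracket *)

Section LieRules.
Variables (U : set M) (q : M).
Hypotheses (oU : open U) (Uq : U q).

Let V := U `&` chart_dom (chart_at q).
Let oV : open V. Proof. exact: openUc. Qed.
Let Vq : V q. Proof. by split => //; exact: chart_at_dom. Qed.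
Let sc i : smooth_on V (coord (chart_at q) i).
Proof.
by apply: sub_smooth_on (smooth_on_coord i (chart_at_atlas q)) => r [].
Qed.
Let sV X : smooth_vf U X -> smooth_vf V X.
Proof. by apply: sub_smooth_vf => r []. Qed.

Lemma lieE X Y i : lie X Y q 0 i = vder X (vder Y (coord (chart_at q) i)) q -
  vder Y (vder X (coord (chart_at q) i)) q.
Proof. by rewrite mxE. Qed.

Lemma lieC X Y : lie X Y q = - lie Y X q.
Proof. by apply/rowP => i; rewrite !mxE opprB. Qed.

Lemma eq_lie X X' Y Y' : (forall r, U r -> X r = X' r) ->
  (forall r, U r -> Y r = Y' r) -> lie X Y q = lie X' Y' q.
Proof.
move=> XX YY; apply/rowP => i.
have E1 : vder X (vder Y (coord (chart_at q) i)) q =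
    vder X' (vder Y' (coord (chart_at q) i)) q.
  rewrite /vder (XX q Uq).
  by apply: (eq_dirder _ oU Uq) => r Ur; rewrite (YY r Ur).
have E2 : vder Y (vder X (coord (chart_at q) i)) q =
    vder Y' (vder X' (coord (chart_at q) i)) q.
  rewrite /vder (YY q Uq).
  by apply: (eq_dirder _ oU Uq) => r Ur; rewrite (XX r Ur).
by rewrite [LHS]lieE [RHS]lieE; exact: (f_equal2 (fun a b => a - b) E1 E2).
Qed.

Lemma lieDr X Y Z : smooth_vf U X -> smooth_vf U Y -> smooth_vf U Z ->
  lie X (fun r => Y r + Z r) q = lie X Y q + lie X Z q.
Proof.
move=> /sV sX /sV sY /sV sZ; apply/rowP => i; rewrite [RHS]mxE.
have A1 : vder X (vder (fun r => Y r + Z r) (coord (chart_at q) i)) q =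
    vder X (vder Y (coord (chart_at q) i)) q +
    vder X (vder Z (coord (chart_at q) i)) q.
  apply: (etrans _ (dirderD _ (smooth_vder oV sY (sc i)) (smooth_vder oV sZ (sc i)) Vq)).
  by apply: (eq_dirder _ oV Vq) => r Vr; exact: (dirderDv _ _ (sc i)).
have A2 := dirderDv (Y q) (Z q) (smooth_vder oV sX (sc i)) Vq.
apply: (etrans (lieE _ _ i)); apply: esym.
apply: (etrans (f_equal2 (fun a b => a + b) (lieE X Y i) (lieE X Z i))).
have alg (a b a1 b1 a2 b2 : R) : a = a1 + a2 -> b = b1 + b2 ->
  a1 - b1 + (a2 - b2) = a - b by move=> -> ->; ring.
exact: alg A1 A2.
Qed.

Lemma lieZr X Y f : smooth_vf U X -> smooth_vf U Y -> smooth_on U f ->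
  lie X (fun r => f r *: Y r) q = vder X f q *: Y q + f q *: lie X Y q.
Proof.
move=> /sV sX /sV sY sf.
have {}sf : smooth_on V f by apply: sub_smooth_on sf => r [].
apply/rowP => i; rewrite [RHS]mxE [X in _ = X + _]mxE [X in _ = _ + X]mxE.
have A1 : vder X (vder (fun r => f r *: Y r) (coord (chart_at q) i)) q =
    f q * vder X (vder Y (coord (chart_at q) i)) q +
    vder Y (coord (chart_at q) i) q * vder X f q.
  apply: (etrans _ (dirderM _ sf (smooth_vder oV sY (sc i)) Vq)).
  by apply: (eq_dirder _ oV Vq) => r Vr; exact: (dirderZv _ _ (sc i)).
have A2 := dirderZv (f q) (Y q) (smooth_vder oV sX (sc i)) Vq.
have A3 := dirder_coord_at q i (Y q).
apply: (etrans (lieE _ _ i)); apply: esym.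
apply: (etrans (f_equal2 (fun a b => a + b) erefl (f_equal (fun a => f q * a) (lieE X Y i)))).
have alg (a b x y a1 b1 z : R) : a = x * a1 + z * y -> b = x * b1 -> z = Y q 0 i ->
  y * Y q 0 i + x * (a1 - b1) = a - b by move=> -> -> ->; ring.
exact: alg A1 A2 A3.
Qed.

Lemma lieDl X Y Z : smooth_vf U X -> smooth_vf U Y -> smooth_vf U Z ->
  lie (fun r => Y r + Z r) X q = lie Y X q + lie Z X q.
Proof.
move=> sX sY sZ; apply: (etrans (lieC _ _)); rewrite (lieDr sX sY sZ) opprD.
by apply: f_equal2; exact/esym/lieC.
Qed.

Lemma lieZl X Y f : smooth_vf U X -> smooth_vf U Y -> smooth_on U f ->
  lie (fun r => f r *: Y r) X q = f q *: lie Y X q - vder X f q *: Y q.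
Proof.
move=> sX sY sf; apply: (etrans (lieC _ _)); rewrite (lieZr sX sY sf).
by rewrite opprD addrC -scalerN -lieC.
Qed.

End LieRules.

(* Phi stands for an expression in a vector field evaluated at p. *)
Section Tensoriality.
Context {W : lmodType R}.
Variables (U : set M) (p : M) (Phi : vfield M -> W).
Hypotheses (oU : open U) (Up : U p).
Hypothesis Phi_local : forall V X Y, open V -> V p -> V `<=` U ->
  smooth_vf V X -> smooth_vf V Y -> (forall q, V q -> X q = Y q) -> Phi X = Phi Y.
Hypothesis PhiD : forall V X Y, open V -> V p -> V `<=` U ->
  smooth_vf V X -> smooth_vf V Y -> Phi (fun q => X q + Y q) = Phi X + Phi Y.
Hypothesis PhiZ : forall V f X, open V -> V p -> V `<=` U -> smooth_on V f ->
  smooth_vf V X -> Phi (fun q => f q *: X q) = f p *: Phi X.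

Let c := chart_at p.
Let V := U `&` chart_dom c.
Let ac : atlas c. Proof. exact: chart_at_atlas. Qed.
Let oV : open V. Proof. exact: openUc. Qed.
Let Vp : V p. Proof. by split => //; exact: chart_at_dom. Qed.
Let VU : V `<=` U. Proof. by move=> r []. Qed.
Let sE v : smooth_vf V (extend p v).
Proof. by apply: sub_smooth_vf (smooth_extend p v) => r []. Qed.

Lemma tensorial_linear : linear (fun v => Phi (extend p v)).
Proof.
move=> a v w; have sa : smooth_on V (fun _ => a) by exact: smooth_on_cst.
have saE := smooth_vfZ oV sa (sE v).
rewrite -(PhiZ oV Vp VU sa (sE v)) -(PhiD oV Vp VU saE (sE w)).
apply: (Phi_local oV Vp VU (sE _) (smooth_vfD oV saE (sE w))) => q [_ cq].
exact: chart_vf_linear.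
Qed.

Lemma tensorial_sum W0 (I : Type) (r : seq I) (a : I -> M -> R)
    (X : I -> vfield M) : open W0 -> W0 p -> W0 `<=` U ->
  (forall i, smooth_on W0 (a i)) -> (forall i, smooth_vf W0 (X i)) ->
  Phi (fun q => \sum_(i <- r) a i q *: X i q) = \sum_(i <- r) a i p *: Phi (X i).
Proof.
move=> oW Wp WU sa sX; elim: r => [|i r IH].
  (* For the empty sum, the zero field is written as the function 0 times a field, so that [PhiZ]
     shows that [Phi] vanishes on it. *)
  have s1 : smooth_on W0 (fun _ => 0) by exact: smooth_on_cst.
  rewrite big_nil -[RHS](scale0r (Phi (fun=> 0))).
  rewrite -(PhiZ oW Wp WU s1 (smooth_vf0 _)).
  apply: (Phi_local oW Wp WU) => [||q _]; last by rewrite big_nil scaler0.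
    by apply: eq_smooth_vf oW _ (smooth_vf0 _) => q _; rewrite big_nil.
  by apply: eq_smooth_vf oW _ (smooth_vf0 _) => q _; rewrite scaler0.
have ss := smooth_vf_sum r oW sa sX; have si := smooth_vfZ oW (sa i) (sX i).
rewrite big_cons -IH -(PhiZ oW Wp WU (sa i) (sX i)) -(PhiD oW Wp WU si ss).
apply: (Phi_local oW Wp WU) => [||q _]; last by rewrite big_cons.
  by apply: eq_smooth_vf oW _ (smooth_vfD oW si ss) => q _; rewrite big_cons.
exact: smooth_vfD.
Qed.

(** Expand X in the coordinate frame around p. Linearity over functions lets [Phi] see the
    coefficients at p only, and freezing them at these values turns the expansion into
    [extend p (X p)]. *)
Lemma tensorialP X : smooth_vf U X -> Phi X = Phi (extend p (X p)).
Proof.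
move=> sX; have sX' : smooth_vf V X by exact: sub_smooth_vf sX.
have sc j : smooth_on V (vder X (coord c j)) by exact: sX.
have se j : smooth_vf V (chart_vf c (delta_mx 0 j)) by exact: sE.
have sk j : smooth_on V (fun=> vder X (coord c j) p) by exact: smooth_on_cst.
transitivity (Phi (fun q => \sum_j vder X (coord c j) q *: chart_vf c (delta_mx 0 j) q)).
  apply: (Phi_local oV Vp VU sX' (smooth_vf_sum _ oV sc se)) => q [_ cq].
  exact: chart_vf_expansion.
rewrite (tensorial_sum _ oV Vp VU sc se) -(tensorial_sum _ oV Vp VU sk se).
apply: (Phi_local oV Vp VU (smooth_vf_sum _ oV sk se) (sE _)) => q [_ cq].
have XpE : X p = \sum_j vder X (coord c j) p *: delta_mx 0 j.
  rewrite [LHS]row_sum_delta; apply: eq_bigr => j _; congr (_ *: _).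
  exact/esym/dirder_coord_at.
have := linear_fun_sum (chart_vf_linear ac cq) (index_enum 'I_d)
  (fun j => vder X (coord c j) p) (fun j => delta_mx 0 j).
by rewrite -XpE.
Qed.

End Tensoriality.

End ManifoldCalculus.

(** * Bilinear forms that admit an orthonormal basis *)

Section OrthonormalBasis.
Context {K : comUnitRingType} {m : nat}.
Variables (g : 'rV[K]_m -> 'rV[K]_m -> K) (F : 'I_m -> 'rV[K]_m).
Hypothesis g_linl : forall w, linear (g ^~ w : 'rV[K]_m -> K^o).
Hypothesis g_linr : forall v, linear (g v : 'rV[K]_m -> K^o).
Hypothesis F_orth : forall i j, g (F i) (F j) = (i == j)%:R.

(** Orthonormality says B C = 1, where B has the rows F_i and C the entries g(e_k, F_i). These
    matrices are square, so C B = 1 as well, which is the expansion of the standard basis. *)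
Lemma orthonormal_expansion v : v = \sum_i g v (F i) *: F i.
Proof.
pose B := \matrix_i F i; pose C := \matrix_(k, i) g (delta_mx 0 k) (F i).
have BC : B *m C = 1%:M.
  apply/matrixP => i j; rewrite !mxE -F_orth [in RHS](row_sum_delta (F i)).
  rewrite (linear_fun_sum (g_linl (F j))).
  by apply: eq_bigr => k _; rewrite !mxE.
have CB := mulmx1C BC.
have -> : \sum_i g v (F i) *: F i = v *m C *m B.
  apply/rowP => k; rewrite summxE [RHS]mxE; apply: eq_bigr => i _.
  rewrite !mxE [in LHS](row_sum_delta v) (linear_fun_sum (g_linl (F i))).
  by congr (_ * _); apply: eq_bigr => l _; rewrite mxE.
by rewrite -mulmxA CB mulmx1.
Qed.

(** Expanding y in the basis gives g(F_i, y) = g(y, F_i), and expanding the first argument of g(v,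
    w) reduces the general case to this one. *)
Lemma orthonormal_sym v w : g v w = g w v.
Proof.
have gE x y : g x y = \sum_i g x (F i) * g (F i) y.
  rewrite [in LHS](orthonormal_expansion x).
  exact: (linear_fun_sum (g_linl y)).
have gF i y : g (F i) y = g y (F i).
  rewrite [in LHS](orthonormal_expansion y) (linear_fun_sum (g_linr (F i))).
  rewrite (bigD1 i)//= big1 ?addr0 => [|j ji].
    by rewrite F_orth eqxx -[LHS]/(_ * _) mulr1.
  by rewrite F_orth eq_sym (negbTE ji) -[LHS]/(_ * _) mulr0.
by rewrite gE [RHS]gE; apply: eq_bigr => i _; rewrite gF -(gF i v) mulrC.
Qed.

Lemma orthonormal_trace (phi : 'rV[K]_m -> 'rV[K]_m) : linear phi ->
  \tr (lin1_mx phi) = \sum_i g (phi (F i)) (F i).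
Proof.
move=> lphi; rewrite /mxtrace.
have phiE k : phi (delta_mx 0 k) = \sum_i g (delta_mx 0 k) (F i) *: phi (F i).
  by rewrite [in LHS](orthonormal_expansion (delta_mx 0 k)) (linear_fun_sum lphi).
under eq_bigr => k _ do rewrite mxE phiE summxE.
rewrite exchange_big; apply: eq_bigr => i _ /=.
rewrite [in RHS](row_sum_delta (phi (F i))) (linear_fun_sum (g_linl (F i))).
by apply: eq_bigr => k _; rewrite mxE mulrC.
Qed.

End OrthonormalBasis.

(* [a] is the Hessian, [c] a connection form, [w] the symplectic form [dtheta]
   and [t] the derivative along [T], all in an orthonormal frame. *)
Lemma bochner_algebra (R : realType) (m : nat) (a c w : 'I_m -> 'I_m -> R) (t : R) :
  (forall i j, c i j = - c j i) ->
  (forall i j, a i j - a j i = - (2 * w i j) * t) ->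
  \sum_i \sum_j a i j * a j i - \sum_i \sum_j c i j * a j i
  - \sum_i \sum_j a i j * c i j - 2 * t * \sum_i \sum_j a i j * w i j =
  \sum_i \sum_j a i j ^+ 2.
Proof.
move=> cC aC; have -> : \sum_i \sum_j c i j * a j i = - \sum_i \sum_j a i j * c i j.
  rewrite exchange_big -sumrN; apply: eq_bigr => i _; rewrite -sumrN.
  by apply: eq_bigr => j _; rewrite cC mulNr mulrC.
(* The sums with [c] are gone. What remains holds for each pair (i, j), because a_ji = a_ij + 2 w_ij
   t. *)
rewrite opprK addrK mulr_sumr -sumrB; apply: eq_bigr => i _.
rewrite mulr_sumr -sumrB; apply: eq_bigr => j _.
have -> : a j i = a i j + 2 * w i j * t by have := aC i j; lra.
ring.
Qed.

(** * The complex structure on H(M) *)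

Section ComplexVectors.
Context {R : realType} {d : nat}.
Implicit Types (z w : 'rV[R[i]]_d) (v : 'rV[R]_d) (a : R).

Lemma complex_vecP z w : re_vec z = re_vec w -> im_vec z = im_vec w -> z = w.
Proof.
move=> /rowP rzw /rowP izw; apply/rowP => j; move: (rzw j) (izw j); rewrite !mxE.
by case: (z 0 j) (w 0 j) => [x y] [x' y'] /= -> ->.
Qed.

Lemma re_vecD z w : re_vec (z + w) = re_vec z + re_vec w.
Proof. by apply/rowP => j; rewrite !mxE; case: (z 0 j) (w 0 j) => [? ?] []. Qed.

Lemma im_vecD z w : im_vec (z + w) = im_vec z + im_vec w.
Proof. by apply/rowP => j; rewrite !mxE; case: (z 0 j) (w 0 j) => [? ?] []. Qed.

Lemma re_vecN z : re_vec (- z) = - re_vec z.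
Proof. by apply/rowP => j; rewrite !mxE; case: (z 0 j). Qed.

Lemma im_vecN z : im_vec (- z) = - im_vec z.
Proof. by apply/rowP => j; rewrite !mxE; case: (z 0 j). Qed.

Lemma re_vec_conj z : re_vec (conj_vec z) = re_vec z.
Proof. by apply/rowP => j; rewrite !mxE; case: (z 0 j). Qed.

Lemma im_vec_conj z : im_vec (conj_vec z) = - im_vec z.
Proof. by apply/rowP => j; rewrite !mxE; case: (z 0 j). Qed.

Lemma re_vecZ (c : R[i]) z :
  re_vec (c *: z) = complex.Re c *: re_vec z - complex.Im c *: im_vec z.
Proof. by apply/rowP => j; rewrite !mxE; case: c (z 0 j) => [? ?] []. Qed.

Lemma im_vecZ (c : R[i]) z :
  im_vec (c *: z) = complex.Re c *: im_vec z + complex.Im c *: re_vec z.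
Proof. by apply/rowP => j; rewrite !mxE; case: c (z 0 j) => [? ?] []. Qed.

Lemma re_vec_real v : re_vec (to_complex v) = v.
Proof. by apply/rowP => j; rewrite !mxE. Qed.

Lemma im_vec_real v : im_vec (to_complex v) = 0.
Proof. by apply/rowP => j; rewrite !mxE. Qed.

Lemma re_vec0 : re_vec (0 : 'rV[R[i]]_d) = 0.
Proof. by apply/rowP => j; rewrite !mxE. Qed.

Lemma im_vec0 : im_vec (0 : 'rV[R[i]]_d) = 0.
Proof. by apply/rowP => j; rewrite !mxE. Qed.

End ComplexVectors.

Section CRAlgebra.
Context {R : realType} {n : nat} {M : crManifold R n}.
Implicit Types (p : M) (z w : 'rV[R[i]]_(2 * n).+1) (v : 'rV[R]_(2 * n).+1).


Lemma T10_linear p (c : R[i]) z w : T10 p z -> T10 p w -> T10 p (c *: z + w).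
Proof.
have [V [Z [oV Vp sZ HT]]] := T10_subbundle p.
have [_ ->] := HT p Vp => /= zA wA.
by apply: addmx_sub wA; exact: scalemx_sub.
Qed.

Lemma T10_0 p : T10 p 0.
Proof.
have [V [Z [oV Vp sZ HT]]] := T10_subbundle p.
by have [_ ->] := HT p Vp; exact: sub0mx.
Qed.

Lemma T10Z p (c : R[i]) z : T10 p z -> T10 p (c *: z).
Proof. by move=> Tz; have := T10_linear c Tz (T10_0 p); rewrite addr0. Qed.

Lemma T10D p z w : T10 p z -> T10 p w -> T10 p (z + w).
Proof. by move=> Tz Tw; have := T10_linear 1 Tz Tw; rewrite scale1r. Qed.

(** The coefficients of z in a local frame of the subbundle, kept constant, define the section. This
    gives access to the torsion axioms, which speak of sections and not of vectors. *)
Lemma T10_section p z : T10 p z ->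
  exists V (Z : cvfield M), [/\ open V, V p, is_section (@T10 R n M) V Z & Z p = z].
Proof.
have [V [Z [oV Vp sZ HT]]] := T10_subbundle p.
have [_ ->] := HT p Vp => /= /submxP[D zE].
exists V, (fun q => \sum_i D 0 i *: Z i q); split => //; last first.
  by rewrite zE mulmx_sum_row; apply: eq_bigr => i _; rewrite rowK.
split; last first.
  move=> q Vq; have [_ ->] := HT q Vq; apply: summx_sub => i _.
  by apply: scalemx_sub; rewrite -[X in (X <= _)%MS](rowK (fun i => Z i q)) row_sub.
have s1 (a : R) : smooth_on V (fun=> a) by exact: smooth_on_cst.
have sre i : smooth_vf V (fun q => complex.Re (D 0 i) *: re_vec (Z i q) -
    complex.Im (D 0 i) *: im_vec (Z i q)).
  have [sr si] := sZ i.
  exact: (smooth_vfB oV (smooth_vfZ oV (s1 _) sr) (smooth_vfZ oV (s1 _) si)).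
have sim i : smooth_vf V (fun q => complex.Re (D 0 i) *: im_vec (Z i q) +
    complex.Im (D 0 i) *: re_vec (Z i q)).
  have [sr si] := sZ i.
  exact: (smooth_vfD oV (smooth_vfZ oV (s1 _) si) (smooth_vfZ oV (s1 _) sr)).
have reS (I : Type) (r : seq I) (F : I -> 'rV[R[i]]_(2 * n).+1) :
    re_vec (\sum_(i <- r) F i) = \sum_(i <- r) re_vec (F i).
  by apply: big_morph; [exact: re_vecD|exact: re_vec0].
have imS (I : Type) (r : seq I) (F : I -> 'rV[R[i]]_(2 * n).+1) :
    im_vec (\sum_(i <- r) F i) = \sum_(i <- r) im_vec (F i).
  by apply: big_morph; [exact: im_vecD|exact: im_vec0].
split.
  apply: eq_smooth_vf oV _ (smooth_vf_sum (index_enum 'I_n) oV (fun=> s1 1) sre).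
  move=> q _; rewrite /re_vf reS; apply: eq_bigr => i _.
  by rewrite scale1r re_vecZ.
apply: eq_smooth_vf oV _ (smooth_vf_sum (index_enum 'I_n) oV (fun=> s1 1) sim).
move=> q _; rewrite /im_vf imS; apply: eq_bigr => i _.
by rewrite scale1r im_vecZ.
Qed.

Lemma HbP p v : Hb p v <-> exists2 z, T10 p z & v = 2 *: re_vec z.
Proof.
split=> [[z [w [Tz Tw ->]]]|[z Tz ->]]; last first.
  by exists z, z; rewrite re_vecD re_vec_conj scaler_nat mulr2n.
(* Conjugation does not change real parts, so Re (z + conj w) = Re z + Re w, which is twice the real
   part of (z + w) / 2. *)
exists ((2^-1 : R)%:C%C *: (z + w)); first exact/T10Z/T10D.
rewrite re_vecZ /= scale0r subr0 scalerA mulfV ?scale1r ?pnatr_eq0//.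
by rewrite !re_vecD re_vec_conj.
Qed.

(** One has z + conj z = 2 Re z and i (z - conj z) = -2 Im z. The vector chosen by [xget] is this
    one because a (1,0) vector is determined by its real part: if Re z = Re z', then z - z' is the
    conjugate of z' - z, hence of both types, hence 0 by [T10_T01]. *)
Lemma JHE p z : T10 p z -> JH p (2 *: re_vec z) = - (2 *: im_vec z).
Proof.
move=> Tz; have ex : [set w | exists2 z', T10 p z' &
    to_complex (2 *: re_vec z) = z' + conj_vec z' /\
    to_complex w = 'i%C *: (z' - conj_vec z')] (- (2 *: im_vec z)).
  exists z => //; split; apply: complex_vecP.
  - by rewrite re_vec_real re_vecD re_vec_conj scaler_nat mulr2n.
  - by rewrite im_vec_real im_vecD im_vec_conj subrr.
  - rewrite re_vec_real re_vecZ /= scale0r scale1r sub0r im_vecD im_vecN.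
    by rewrite im_vec_conj opprK scaler_nat mulr2n.
  - rewrite im_vec_real im_vecZ /= scale0r scale1r add0r re_vecD re_vecN.
    by rewrite re_vec_conj subrr.
have [z' Tz' [vE wE]] := xgetPex 0 (ex_intro _ _ ex).
have zz' : z - z' = 0.
  apply: (T10_T01 (p := p)).
    by rewrite addrC -scaleN1r; exact: T10_linear.
  exists (z' - z); first by rewrite addrC -scaleN1r; exact: T10_linear.
  apply: complex_vecP; rewrite ?re_vec_conj ?im_vec_conj ?im_vecD ?im_vecN ?opprB//.
  have E := congr1 re_vec vE.
  rewrite re_vec_real re_vecD re_vec_conj -mulr2n in E.
  have n2 : (2%:R : R) != 0 by rewrite pnatr_eq0.
  by rewrite !re_vecD !re_vecN (scalerI n2 (etrans E (esym (scaler_nat 2 _)))).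
have {}zz' : z' = z by apply/esym/eqP; rewrite -subr_eq0 zz'.
rewrite -[LHS]re_vec_real wE zz' re_vecZ /= scale0r scale1r sub0r im_vecD im_vecN.
by rewrite im_vec_conj opprK scaler_nat mulr2n.
Qed.

Lemma JH_Hb p v : Hb p v -> Hb p (JH p v).
Proof.
move=> /HbP[z Tz ->]; rewrite JHE//; apply/HbP.
exists ('i%C *: z); first exact: T10Z.
by rewrite re_vecZ /= scale0r scale1r sub0r scalerN.
Qed.

Lemma JHK p v : Hb p v -> JH p (JH p v) = - v.
Proof.
move=> /HbP[z Tz ->]; rewrite JHE//.
have -> : - (2 *: im_vec z) = 2 *: re_vec ('i%C *: z).
  by rewrite re_vecZ /= scale0r scale1r sub0r scalerN.
rewrite JHE; last exact: T10Z.
by rewrite im_vecZ /= scale0r scale1r add0r.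
Qed.

Lemma JH_linear p (a : R) v u : Hb p v -> Hb p u ->
  JH p (a *: v + u) = a *: JH p v + JH p u.
Proof.
move=> /HbP[z Tz ->] /HbP[z' Tz' ->].
have -> : a *: (2 *: re_vec z) + 2 *: re_vec z' = 2 *: re_vec (a%:C%C *: z + z').
  by rewrite re_vecD re_vecZ /= scale0r subr0 scalerDr !scalerA mulrC.
rewrite !JHE//; last exact: T10_linear.
rewrite im_vecD im_vecZ /= scale0r addr0 scalerDr opprD !scalerN !scalerA.
by rewrite mulrC.
Qed.

End CRAlgebra.

(** * Exterior derivative, torsion and curvature as tensors *)

Section Tensors.
Context {R : realType} {d : nat} {M : orientedManifold R d}.
Implicit Types (U V : set M) (p q : M) (f : M -> R) (v w : 'rV[R]_d)
  (X Y Z : vfield M).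

Let openUc U c : open U -> open (U `&` chart_dom (chart_at (o := M) c)).
Proof. by move=> oU; apply: openI => //; exact: chart_dom_open. Qed.

Let Uc U c : U c -> (U `&` chart_dom (chart_at (o := M) c)) c.
Proof. by split => //; exact: chart_at_dom. Qed.

Lemma smooth_extendI U p v : smooth_vf (U `&` chart_dom (chart_at (o := M) p)) (extend p v).
Proof. by apply: sub_smooth_vf (smooth_extend p v) => r []. Qed.

(** * The exterior derivative of a 1-form as a bilinear form on tangent vectors *)

Section ExteriorDerivative.
Variable theta : oneform M.
Hypothesis theta1 : is_oneform theta.

Let th_lin p : linear (theta p : 'rV[R]_d -> R^o). Proof. exact: theta1.1. Qed.

Lemma smooth_oneform U X : open U -> smooth_vf U X ->
  smooth_on U (fun q => theta q (X q)).
Proof.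
move=> oU sX; apply: smooth_on_charts => c ac.
have oUc : open (U `&` chart_dom c) by apply: openI => //; exact: chart_dom_open.
have sm (j : 'I_d) : smooth_on (U `&` chart_dom c)
    (fun q => vder X (coord c j) q * theta q (chart_vf c (delta_mx 0 j) q)).
  apply: smooth_onM => //; first exact: sX.
  by apply: sub_smooth_on (theta1.2 c (delta_mx 0 j) ac) => q [].
apply: eq_smooth_on oUc _ (smooth_on_sum (index_enum 'I_d) oUc sm) => q [Uq cq].
rewrite [in RHS](chart_vf_expansion (X q) ac cq).
by rewrite (linear_fun_sum (th_lin q)).
Qed.

Lemma extder_vfC X Y p : extder_vf theta X Y p = - extder_vf theta Y X p.
Proof.
have A3 : theta p (lie X Y p) = - theta p (lie Y X p).
  by rewrite -(linear_funN (th_lin p)); exact: (f_equal (theta p) (lieC p X Y)).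
have alg (a b c c' : R) : c = - c' ->
  2^-1 * (a - b - c) = - (2^-1 * (b - a - c')) by move=> ->; ring.
exact: alg A3.
Qed.

Lemma eq_extder_vf U p X X' Y : open U -> U p ->
  (forall q, U q -> X q = X' q) -> extder_vf theta X Y p = extder_vf theta X' Y p.
Proof.
move=> oU Up XX.
have A1 : vder X (fun r => theta r (Y r)) p = vder X' (fun r => theta r (Y r)) p.
  by rewrite /vder (XX p Up).
have A2 : vder Y (fun r => theta r (X r)) p = vder Y (fun r => theta r (X' r)) p.
  by apply: (eq_dirder _ oU Up) => r Ur; rewrite (XX r Ur).
have A3 : theta p (lie X Y p) = theta p (lie X' Y p).
  by apply: (f_equal (theta p)); apply: (eq_lie oU Up).
have alg (a b c a' b' c' : R) : a = a' -> b = b' -> c = c' ->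
  2^-1 * (a - b - c) = 2^-1 * (a' - b' - c') by move=> -> -> ->.
exact: alg A1 A2 A3.
Qed.

Lemma extder_vfD U p X X' Y : open U -> U p ->
  smooth_vf U X -> smooth_vf U X' -> smooth_vf U Y ->
  extder_vf theta (fun q => X q + X' q) Y p =
  extder_vf theta X Y p + extder_vf theta X' Y p.
Proof.
move=> oU Up sX sX' sY.
have A1 := dirderDv (X p) (X' p) (smooth_oneform oU sY) Up.
have A2 : vder Y (fun r => theta r (X r + X' r)) p =
    vder Y (fun r => theta r (X r)) p + vder Y (fun r => theta r (X' r)) p.
  apply: (etrans _ (dirderD _ (smooth_oneform oU sX) (smooth_oneform oU sX') Up)).
  by apply: (eq_dirder _ oU Up) => r Ur; rewrite (linear_funD (th_lin r)).
have A3 : theta p (lie (fun r => X r + X' r) Y p) =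
    theta p (lie X Y p) + theta p (lie X' Y p).
  rewrite -(linear_funD (th_lin p)); apply: (f_equal (theta p)).
  exact: (lieDl oU Up).
have alg (a b c a1 b1 c1 a2 b2 c2 : R) : a = a1 + a2 -> b = b1 + b2 -> c = c1 + c2 ->
  2^-1 * (a - b - c) = 2^-1 * (a1 - b1 - c1) + 2^-1 * (a2 - b2 - c2).
  by move=> -> -> ->; ring.
exact: alg A1 A2 A3.
Qed.

(** The term theta(X) Y(f) from differentiating f theta(X) cancels the one produced by the bracket
    [f X, Y]. *)
Lemma extder_vfZ U p f X Y : open U -> U p -> smooth_on U f ->
  smooth_vf U X -> smooth_vf U Y ->
  extder_vf theta (fun q => f q *: X q) Y p = f p * extder_vf theta X Y p.
Proof.
move=> oU Up sf sX sY.
have A1 := dirderZv (f p) (X p) (smooth_oneform oU sY) Up.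
have A2 : vder Y (fun r => theta r (f r *: X r)) p =
    f p * vder Y (fun r => theta r (X r)) p + theta p (X p) * vder Y f p.
  apply: (etrans _ (dirderM _ sf (smooth_oneform oU sX) Up)).
  by apply: (eq_dirder _ oU Up) => r Ur; rewrite (linear_funZ (th_lin r)).
have A3 : theta p (lie (fun r => f r *: X r) Y p) =
    f p * theta p (lie X Y p) - vder Y f p * theta p (X p).
  apply: (etrans (f_equal (theta p) (lieZl oU Up sY sX sf))).
  by rewrite (linear_funB (th_lin p)) !(linear_funZ (th_lin p)).
have alg (x a b c a1 b1 c1 t y : R) : a = x * a1 -> b = x * b1 + t * y ->
  c = x * c1 - y * t -> 2^-1 * (a - b - c) = x * (2^-1 * (a1 - b1 - c1)).
  by move=> -> -> ->; ring.
exact: alg A1 A2 A3.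
Qed.

Lemma extder_vfE U p X Y : open U -> U p -> smooth_vf U X -> smooth_vf U Y ->
  extder_vf theta X Y p = extder theta p (X p) (Y p).
Proof.
(* Tensoriality in the first slot; antisymmetry carries it to the second. The neighbourhood stays
   arbitrary because the second use involves an extended field, smooth on a chart domain only. *)
have key V X0 Y0 : open V -> V p -> smooth_vf V X0 -> smooth_vf V Y0 ->
    extder_vf theta X0 Y0 p = extder_vf theta (extend p (X0 p)) Y0 p.
  move=> oV Vp sX sY.
  refine (tensorialP (W := R^o) (Phi := fun X => extder_vf theta X Y0 p) oV Vp _ _ _ sX).
  - by move=> V' X1 X2 oV' V'p V'V sX1 sX2; exact: (eq_extder_vf _ oV' V'p).
  - move=> V' X1 X2 oV' V'p V'V sX1 sX2.
    exact: (extder_vfD oV' V'p sX1 sX2 (sub_smooth_vf V'V sY)).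
  - move=> V' f0 X1 oV' V'p V'V sf sX1.
    exact: (extder_vfZ oV' V'p sf sX1 (sub_smooth_vf V'V sY)).
move=> oU Up sX sY; apply: (etrans (key U X Y oU Up sX sY)).
apply: (etrans (extder_vfC _ _ _)); apply/esym/(etrans (extder_vfC _ _ _)).
apply: (f_equal -%R); apply: esym.
apply: (key _ _ _ (openUc p oU) (Uc Up)).
  by apply: sub_smooth_vf sY => r [].
exact: smooth_extendI.
Qed.

Lemma extderC p v w : extder theta p v w = - extder theta p w v.
Proof. exact: extder_vfC. Qed.

Lemma extder_linl p w : linear (fun v => extder theta p v w : R^o).
Proof.
have oT := chart_dom_open (chart_at p); have Tp := chart_at_dom p.
apply: (tensorial_linear (U := chart_dom (chart_at p))
  (Phi := fun X => extder_vf theta X (extend p w) p : R^o) oT Tp).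
- by move=> V' X1 X2 oV' V'p V'V sX1 sX2; exact: (eq_extder_vf _ oV' V'p).
- move=> V' X1 X2 oV' V'p V'V sX1 sX2.
  exact: (extder_vfD oV' V'p sX1 sX2
    (sub_smooth_vf V'V (smooth_extend p w))).
- move=> V' f0 X1 oV' V'p V'V sf sX1.
  exact: (extder_vfZ oV' V'p sf sX1
    (sub_smooth_vf V'V (smooth_extend p w))).
Qed.

Lemma extder_linr p v : linear (fun w => extder theta p v w : R^o).
Proof.
move=> a w w'; apply: (etrans (extderC p _ _)).
apply: (etrans (f_equal -%R (extder_linl p v a w w'))).
rewrite opprD -scalerN; apply: f_equal2; last exact/esym/extderC.
by apply: (f_equal (fun x : R => a * x)); exact/esym/extderC.
Qed.

End ExteriorDerivative.

(** * Tensoriality of torsion and curvature *)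

Section TorsionCurvature.
Variable nabla : connection M.
Hypothesis cn : is_connection nabla.

Lemma eq_cov U X X' Y Y' p : open U -> U p -> smooth_vf U Y -> smooth_vf U Y' ->
  X p = X' p -> (forall q, U q -> Y q = Y' q) -> cov nabla X Y p = cov nabla X' Y' p.
Proof.
by move=> oU Up sY sY' XX YY; rewrite /cov XX; exact: (conn_local cn _ oU Up).
Qed.

Lemma torsionC X Y p : torsion nabla X Y p = - torsion nabla Y X p.
Proof.
have alg (a b c c' : 'rV[R]_d) : c = - c' -> a - b - c = - (b - a - c').
  by move=> ->; apply/rowP => i; rewrite !mxE; ring.
exact: alg (lieC p X Y).
Qed.

Lemma eq_torsion U p X X' Y : open U -> U p -> smooth_vf U X -> smooth_vf U X' ->
  (forall q, U q -> X q = X' q) -> torsion nabla X Y p = torsion nabla X' Y p.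
Proof.
move=> oU Up sX sX' XX.
have A1 : cov nabla X Y p = cov nabla X' Y p by rewrite /cov (XX p Up).
have A2 : cov nabla Y X p = cov nabla Y X' p by exact: (eq_cov oU Up sX sX').
have A3 : lie X Y p = lie X' Y p by exact: (eq_lie oU Up).
exact: (f_equal2 (fun a b => a - b) (f_equal2 (fun a b => a - b) A1 A2) A3).
Qed.

Lemma torsionD U p X X' Y : open U -> U p ->
  smooth_vf U X -> smooth_vf U X' -> smooth_vf U Y ->
  torsion nabla (fun q => X q + X' q) Y p =
  torsion nabla X Y p + torsion nabla X' Y p.
Proof.
move=> oU Up sX sX' sY.
have A1 := linear_funD (conn_linear cn oU Up sY) (X p) (X' p).
have A2 := conn_additive cn (Y p) oU Up sX sX'.
have A3 := lieDl oU Up sY sX sX'.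
have alg (a b c a1 b1 c1 a2 b2 c2 : 'rV[R]_d) :
    a = a1 + a2 -> b = b1 + b2 -> c = c1 + c2 ->
    a - b - c = (a1 - b1 - c1) + (a2 - b2 - c2).
  by move=> -> -> ->; apply/rowP => i; rewrite !mxE; ring.
exact: alg A1 A2 A3.
Qed.

Lemma torsionZ U p f X Y : open U -> U p -> smooth_on U f ->
  smooth_vf U X -> smooth_vf U Y ->
  torsion nabla (fun q => f q *: X q) Y p = f p *: torsion nabla X Y p.
Proof.
move=> oU Up sf sX sY.
have A1 := linear_funZ (conn_linear cn oU Up sY) (f p) (X p).
have A2 := conn_leibniz cn (Y p) oU Up sf sX.
have A3 := lieZl oU Up sY sX sf.
have alg (x y : R) (a b c a1 b1 c1 t : 'rV[R]_d) :
    a = x *: a1 -> b = y *: t + x *: b1 -> c = x *: c1 - y *: t ->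
    a - b - c = x *: (a1 - b1 - c1).
  by move=> -> -> ->; apply/rowP => i; rewrite !mxE; ring.
exact: alg A1 A2 A3.
Qed.

Lemma torsionE U p X Y : open U -> U p -> smooth_vf U X -> smooth_vf U Y ->
  torsion nabla X Y p = torsion nabla (extend p (X p)) (extend p (Y p)) p.
Proof.
have key V X0 Y0 : open V -> V p -> smooth_vf V X0 -> smooth_vf V Y0 ->
    torsion nabla X0 Y0 p = torsion nabla (extend p (X0 p)) Y0 p.
  move=> oV Vp sX sY.
  refine (tensorialP (Phi := fun X => torsion nabla X Y0 p) oV Vp _ _ _ sX).
  - by move=> V' X1 X2 oV' V'p V'V sX1 sX2; exact: (eq_torsion _ oV' V'p sX1 sX2).
  - move=> V' X1 X2 oV' V'p V'V sX1 sX2.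
    exact: (torsionD oV' V'p sX1 sX2 (sub_smooth_vf V'V sY)).
  - move=> V' f0 X1 oV' V'p V'V sf sX1.
    exact: (torsionZ oV' V'p sf sX1 (sub_smooth_vf V'V sY)).
move=> oU Up sX sY; apply: (etrans (key U X Y oU Up sX sY)).
apply: (etrans (torsionC _ _ _)); apply/esym/(etrans (torsionC _ _ _)).
apply: (f_equal -%R); apply: esym.
apply: (key _ _ _ (openUc p oU) (Uc Up)).
  by apply: sub_smooth_vf sY => r [].
exact: smooth_extendI.
Qed.

Definition torsion_at p v w := torsion nabla (extend p v) (extend p w) p.

Lemma torsion_atC p v w : torsion_at p v w = - torsion_at p w v.
Proof. exact: torsionC. Qed.

Lemma torsion_at_linl p w : linear (fun v => torsion_at p v w).
Proof.
have oT := chart_dom_open (chart_at p); have Tp := chart_at_dom p.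
apply: (tensorial_linear (U := chart_dom (chart_at p))
  (Phi := fun X => torsion nabla X (extend p w) p) oT Tp).
- by move=> V' X1 X2 oV' V'p V'V sX1 sX2; exact: (eq_torsion _ oV' V'p sX1 sX2).
- move=> V' X1 X2 oV' V'p V'V sX1 sX2.
  exact: (torsionD oV' V'p sX1 sX2
    (sub_smooth_vf V'V (smooth_extend p w))).
- move=> V' f0 X1 oV' V'p V'V sf sX1.
  exact: (torsionZ oV' V'p sf sX1
    (sub_smooth_vf V'V (smooth_extend p w))).
Qed.

Lemma torsion_at_linr p v : linear (torsion_at p v).
Proof.
move=> a w w'; apply: (etrans (torsion_atC p _ _)).
apply: (etrans (f_equal -%R (torsion_at_linl p v a w w'))).
rewrite opprD -scalerN; apply: f_equal2; last exact/esym/torsion_atC.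
by apply: (f_equal (fun x => a *: x)); exact/esym/torsion_atC.
Qed.

Section Curvature.
Variables (U : set M) (p : M) (Y Z : vfield M).
Hypotheses (oU : open U) (Up : U p) (sY : smooth_vf U Y) (sZ : smooth_vf U Z).

Let sub V X : V `<=` U -> smooth_vf U X -> smooth_vf V X.
Proof. exact: sub_smooth_vf. Qed.

Lemma eq_curvature V X X' : open V -> V p -> V `<=` U -> smooth_vf V X ->
  smooth_vf V X' -> (forall q, V q -> X q = X' q) ->
  curvature nabla X Y Z p = curvature nabla X' Y Z p.
Proof.
move=> oV Vp VU sX sX' XX; have sYV := sub VU sY; have sZV := sub VU sZ.
have A1 : cov nabla X (cov nabla Y Z) p = cov nabla X' (cov nabla Y Z) p.
  by rewrite /cov (XX p Vp).
have A2 : cov nabla Y (cov nabla X Z) p = cov nabla Y (cov nabla X' Z) p.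
  have XXZ q : V q -> cov nabla X Z q = cov nabla X' Z q.
    by move=> Vq; rewrite /cov (XX q Vq).
  exact: (conn_local cn (Y p) oV Vp (conn_smooth cn oV sX sZV)
    (conn_smooth cn oV sX' sZV) XXZ).
have A3 : cov nabla (lie X Y) Z p = cov nabla (lie X' Y) Z p.
  by apply: (f_equal (fun v => nabla p v Z)); exact: (eq_lie oV Vp).
exact: (f_equal2 (fun a b => a - b) (f_equal2 (fun a b => a - b) A1 A2) A3).
Qed.

Lemma curvatureD V X X' : open V -> V p -> V `<=` U -> smooth_vf V X ->
  smooth_vf V X' -> curvature nabla (fun q => X q + X' q) Y Z p =
  curvature nabla X Y Z p + curvature nabla X' Y Z p.
Proof.
move=> oV Vp VU sX sX'; have sYV := sub VU sY; have sZV := sub VU sZ.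
have sXZ := conn_smooth cn oV sX sZV; have sXZ' := conn_smooth cn oV sX' sZV.
have A1 := linear_funD (conn_linear cn oV Vp (conn_smooth cn oV sYV sZV)) (X p) (X' p).
have A2 : cov nabla Y (cov nabla (fun q => X q + X' q) Z) p =
    cov nabla Y (cov nabla X Z) p + cov nabla Y (cov nabla X' Z) p.
  apply: (etrans _ (conn_additive cn (Y p) oV Vp sXZ sXZ')).
  apply: (conn_local cn _ oV Vp); first exact: (conn_smooth cn oV (smooth_vfD oV sX sX')).
    exact: smooth_vfD.
  by move=> q Vq; exact: (linear_funD (conn_linear cn oV Vq sZV)).
have A3 : cov nabla (lie (fun q => X q + X' q) Y) Z p =
    cov nabla (lie X Y) Z p + cov nabla (lie X' Y) Z p.
  apply: (etrans _ (linear_funD (conn_linear cn oV Vp sZV) _ _)).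
  by apply: (f_equal (fun v => nabla p v Z)); exact: (lieDl oV Vp).
have alg (a b c a1 b1 c1 a2 b2 c2 : 'rV[R]_d) :
    a = a1 + a2 -> b = b1 + b2 -> c = c1 + c2 ->
    a - b - c = (a1 - b1 - c1) + (a2 - b2 - c2).
  by move=> -> -> ->; apply/rowP => i; rewrite !mxE; ring.
exact: alg A1 A2 A3.
Qed.

(** Differentiating f nabla_X Z along Y gives Y(f) nabla_X Z, which the bracket [f X, Y] removes. *)
Lemma curvatureZ V f X : open V -> V p -> V `<=` U -> smooth_on V f ->
  smooth_vf V X -> curvature nabla (fun q => f q *: X q) Y Z p =
  f p *: curvature nabla X Y Z p.
Proof.
move=> oV Vp VU sf sX; have sYV := sub VU sY; have sZV := sub VU sZ.
have sXZ := conn_smooth cn oV sX sZV.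
have A1 := linear_funZ (conn_linear cn oV Vp (conn_smooth cn oV sYV sZV)) (f p) (X p).
have A2 : cov nabla Y (cov nabla (fun q => f q *: X q) Z) p =
    vder Y f p *: cov nabla X Z p + f p *: cov nabla Y (cov nabla X Z) p.
  apply: (etrans _ (conn_leibniz cn (Y p) oV Vp sf sXZ)).
  apply: (conn_local cn _ oV Vp); first exact: (conn_smooth cn oV (smooth_vfZ oV sf sX)).
    exact: smooth_vfZ.
  by move=> q Vq; exact: (linear_funZ (conn_linear cn oV Vq sZV)).
have A3 : cov nabla (lie (fun q => f q *: X q) Y) Z p =
    f p *: cov nabla (lie X Y) Z p - vder Y f p *: cov nabla X Z p.
  have lc := conn_linear cn oV Vp sZV.
  apply: (etrans (f_equal (fun v => nabla p v Z) (lieZl oV Vp sYV sX sf))).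
  apply: (etrans (linear_funB lc _ _)).
  exact: (f_equal2 (fun a b => a - b) (linear_funZ lc _ _) (linear_funZ lc _ _)).
have alg (x y : R) (a b c a1 b1 c1 t : 'rV[R]_d) :
    a = x *: a1 -> b = y *: t + x *: b1 -> c = x *: c1 - y *: t ->
    a - b - c = x *: (a1 - b1 - c1).
  by move=> -> -> ->; apply/rowP => i; rewrite !mxE; ring.
exact: alg A1 A2 A3.
Qed.

(** The slot treated here is the one over which [ricci] takes the trace; in [ricci] the other two
    arguments are genuine fields. *)
Lemma curvature_linear : linear (fun v => curvature nabla (extend p v) Y Z p).
Proof.
apply: (tensorial_linear (U := U) (Phi := fun X => curvature nabla X Y Z p) oU Up).
- exact: eq_curvature.
- exact: curvatureD.
- exact: curvatureZ.
Qed.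

Lemma curvatureE X : smooth_vf U X ->
  curvature nabla X Y Z p = curvature nabla (extend p (X p)) Y Z p.
Proof.
apply: (tensorialP (U := U) (Phi := fun X => curvature nabla X Y Z p) oU Up).
- exact: eq_curvature.
- exact: curvatureD.
- exact: curvatureZ.
Qed.

End Curvature.

End TorsionCurvature.

End Tensors.

(** * Pseudohermitian geometry in an orthonormal frame *)

Section Pseudohermitian.
Context {R : realType} {n : nat} {M : crManifold R n}.
Variables (theta : oneform M) (T : vfield M) (nabla D : connection M).
Hypotheses (theta_psh : is_pseudohermitian theta)
  (T_char : is_characteristic theta T)
  (nabla_tw : is_tanaka_webster theta T nabla)
  (D_lc : is_levi_civita (webster theta T) D).
Implicit Types (V : set M) (p q : M) (X Y Z : vfield M) (v w : 'rV[R]_(2 * n).+1).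

Local Notation g := (webster theta T).

Let th1 : is_oneform theta. Proof. by have [] := theta_psh. Qed.
Let th_lin p : linear (theta p : 'rV[R]_(2 * n).+1 -> R^o).
Proof. by have [] := th1. Qed.
Let cn : is_connection nabla. Proof. exact: tw_connection nabla_tw. Qed.

Lemma Hb_theta p v : Hb p v <-> theta p v = 0.
Proof. by have [_ <-] := theta_psh. Qed.

Lemma theta_T p : theta p (T p) = 1.
Proof. by have [_ /(_ p)[]] := T_char. Qed.

Lemma extder_T p v : extder theta p (T p) v = 0.
Proof. by have [_ /(_ p)[_ ->]] := T_char. Qed.

Lemma smooth_T V : smooth_vf V T.
Proof. by have [sT _] := T_char; apply: sub_smooth_vf sT. Qed.

Lemma piH_Hb p v : Hb p (piH theta T p v).
Proof.
apply/Hb_theta; rewrite /piH (linear_funB (th_lin p)) (linear_funZ (th_lin p)).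
by rewrite theta_T -[_ *: 1]/(_ * 1) mulr1 subrr.
Qed.

Lemma piH_id p v : Hb p v -> piH theta T p v = v.
Proof. by move=> /Hb_theta v0; rewrite /piH v0 scale0r subr0. Qed.

Lemma piH_T p : piH theta T p (T p) = 0.
Proof. by rewrite /piH theta_T scale1r subrr. Qed.

Lemma piH_linear p : linear (piH theta T p).
Proof.
move=> a v w; rewrite /piH (th_lin p) scalerDl scalerBr opprD addrACA.
by rewrite -[_ *: theta p v]/(_ * _) scalerA.
Qed.

Lemma Hb_comb p (a : R) v w : Hb p v -> Hb p w -> Hb p (a *: v + w).
Proof.
move=> /Hb_theta v0 /Hb_theta w0; apply/Hb_theta.
by rewrite (th_lin p) v0 w0 addr0 -[_ *: 0]/(_ * 0) mulr0.
Qed.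

Lemma Hb0 p : Hb p 0.
Proof. by apply/Hb_theta; exact: linear_fun0 (th_lin p). Qed.

Lemma HbZ p (a : R) v : Hb p v -> Hb p (a *: v).
Proof. by move=> Hv; have := Hb_comb a Hv (Hb0 p); rewrite addr0. Qed.

Lemma HbD p v w : Hb p v -> Hb p w -> Hb p (v + w).
Proof. by move=> Hv Hw; have := Hb_comb 1 Hv Hw; rewrite scale1r. Qed.

Lemma webster_linl p w : linear (g p ^~ w : 'rV[R]_(2 * n).+1 -> R^o).
Proof.
move=> a v v'; rewrite /webster /levi_form piH_linear.
rewrite (extder_linl th1 p _ a) (th_lin p).
have alg (x1 x2 b1 b2 y : R) :
  (a * x1 + x2) + (a * b1 + b2) * y = a * (x1 + b1 * y) + (x2 + b2 * y) by ring.
exact: alg.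
Qed.

Lemma webster_linr p v : linear (g p v : 'rV[R]_(2 * n).+1 -> R^o).
Proof.
move=> a w w'; rewrite /webster /levi_form piH_linear JH_linear; try exact: piH_Hb.
rewrite (extder_linr th1 p _ a) (th_lin p).
have alg (x1 x2 b1 b2 y : R) :
  (a * x1 + x2) + y * (a * b1 + b2) = a * (x1 + y * b1) + (x2 + y * b2) by ring.
exact: alg.
Qed.

Lemma JH0 p : JH p 0 = 0.
Proof.
have := JH_linear 1 (Hb0 p) (Hb0 p); rewrite !scale1r addr0 => /eqP.
by rewrite -subr_eq0 opprD addrA subrr sub0r oppr_eq0 => /eqP.
Qed.

Lemma webster_T p v : g p v (T p) = theta p v.
Proof.
rewrite /webster piH_T /levi_form JH0 theta_T mulr1.
by rewrite (linear_fun0 (extder_linr th1 p _)) add0r.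
Qed.

Lemma websterT p v : g p (T p) v = theta p v.
Proof.
rewrite /webster piH_T /levi_form theta_T mul1r.
by rewrite (linear_fun0 (extder_linl th1 p _)) add0r.
Qed.

Lemma webster_Hb p v w : Hb p v -> Hb p w -> g p v w = extder theta p v (JH p w).
Proof.
move=> Hv Hw; rewrite /webster !piH_id// /levi_form.
by have /Hb_theta-> := Hv; rewrite mul0r addr0.
Qed.

Lemma JextE p v : Hb p v -> Jext theta T p v = JH p v.
Proof. by move=> Hv; rewrite /Jext piH_id. Qed.

Lemma eq0_vder V (phi : M -> R) (a : R) q v : open V -> V q ->
  (forall r, V r -> phi r = a) -> dirder phi q v = 0.
Proof.
move=> oV Vq ph; rewrite -(dirder_cst (M := M) a q v).
exact: (eq_dirder _ oV Vq).
Qed.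

Lemma nabla_Hb V X q v : open V -> V q -> smooth_vf V X ->
  (forall r, V r -> Hb r (X r)) -> Hb q (nabla q v X).
Proof.
by move=> oV Vq sX HX; exact: (tw_H_parallel nabla_tw v oV Vq sX HX).
Qed.

(** H(M) is parallel, so theta kills both covariant derivatives and leaves -theta([X, Y]). This is 2
    dtheta(X, Y), since theta(X) and theta(Y) vanish identically. *)
Lemma theta_torsion V X Y q : open V -> V q -> smooth_vf V X -> smooth_vf V Y ->
  (forall r, V r -> Hb r (X r)) -> (forall r, V r -> Hb r (Y r)) ->
  theta q (torsion nabla X Y q) = 2 * extder theta q (X q) (Y q).
Proof.
move=> oV Vq sX sY HX HY.
have B1 : theta q (cov nabla X Y q) = 0 by apply/Hb_theta; exact: (nabla_Hb _ oV Vq sY HY).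
have B2 : theta q (cov nabla Y X q) = 0 by apply/Hb_theta; exact: (nabla_Hb _ oV Vq sX HX).
have A1 : vder X (fun r => theta r (Y r)) q = 0.
  by apply: (eq0_vder (a := 0) _ oV Vq) => r /HY/Hb_theta.
have A2 : vder Y (fun r => theta r (X r)) q = 0.
  by apply: (eq0_vder (a := 0) _ oV Vq) => r /HX/Hb_theta.
apply: etrans (f_equal (fun x => 2 * x) (extder_vfE th1 oV Vq sX sY)).
have L := etrans (linear_funB (th_lin q) _ (lie X Y q))
  (f_equal (fun x => x - theta q (lie X Y q)) (linear_funB (th_lin q)
    (cov nabla X Y q) (cov nabla Y X q))).
apply: (etrans L); have alg (x y a b c : R) : x = 0 -> y = 0 -> a = 0 -> b = 0 ->
    x - y - c = 2 * (2^-1 * (a - b - c)).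
  by move=> -> -> -> ->; field.
exact: alg B1 B2 A1 A2.
Qed.

(* Write v = 2 Re z and w = 2 Re z' with z = a + ib and z' = c + id of type (1,0).
   The real parts of the two axioms on (z, z') and (z, conj z') say that
   tau(a, c) = tau(b, d) and that tau(a, c) + tau(b, d) is a multiple of T. *)
Lemma torsion_at_vertical q v w : Hb q v -> Hb q w ->
  exists k, torsion_at nabla q v w = k *: T q.
Proof.
move=> /HbP[z Tz ->] /HbP[z' Tz' ->].
have [V1 [Z [oV1 V1q [[srZ siZ] TZ] Zq]]] := T10_section Tz.
have [V2 [W [oV2 V2q [[srW siW] TW] Wq]]] := T10_section Tz'.
pose V := V1 `&` V2; have oV : open V by exact: openI.
have Vq : V q by [].
have sub1 : V `<=` V1 by move=> r [].
have sub2 : V `<=` V2 by move=> r [].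
have sZr := sub_smooth_vf sub1 srZ; have sZi := sub_smooth_vf sub1 siZ.
have sWr := sub_smooth_vf sub2 srW; have sWi := sub_smooth_vf sub2 siW.
have sZ : is_section (@T10 R n M) V Z by split => // r /sub1/TZ.
have sW : is_section (@T10 R n M) V W by split => // r /sub2/TW.
have E1 := congr1 re_vec (tw_torsion_ZW nabla_tw oV Vq sZ sW).
have E2 := congr1 re_vec (tw_torsion_ZWbar nabla_tw oV Vq sZ sW).
have reC (A B : 'rV[R]_(2 * n).+1) : re_vec (to_complex A + 'i%C *: to_complex B) = A.
  by rewrite re_vecD re_vecZ re_vec_real re_vec_real im_vec_real /= scale0r scaler0 subr0 addr0.
have {}E1 := etrans (esym (reC _ _)) (etrans E1 (re_vec0)).
have {}E2 := etrans (esym (reC _ _)) E2.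
have rcW : re_vf (fun r => conj_vec (W r)) = re_vf W.
  by apply/funext => r; exact: re_vec_conj.
have icW : im_vf (fun r => conj_vec (W r)) = (fun r => - im_vf W r).
  by apply/funext => r; exact: im_vec_conj.
rewrite rcW icW in E2.
have sWi' : smooth_vf V (fun r => - im_vf W r).
  apply: eq_smooth_vf oV _ (smooth_vfZ oV (smooth_on_cst V (-1)) sWi) => r _.
  exact: scaleN1r.
have t1 := torsionE cn oV Vq sZr sWr; have t2 := torsionE cn oV Vq sZi sWi.
have t3 := torsionE cn oV Vq sZi sWi'.
have t4 : torsion nabla (im_vf Z) (fun r => - im_vf W r) q = - torsion nabla (im_vf Z) (im_vf W) q.
  apply: (etrans t3); apply: (etrans (linear_funN (torsion_at_linr cn q _) _)).
  exact: (f_equal -%R (esym t2)).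
have E3 : re_vec ((2 * 'i%C * cbilin_form (levi_form theta q) (Z q)
    (conj_vec (W q))) *: to_complex (T q)) =
  complex.Re (2 * 'i%C * cbilin_form (levi_form theta q) (Z q) (conj_vec (W q))) *: T q.
  by rewrite re_vecZ re_vec_real im_vec_real scaler0 subr0.
move: E3 E2; set c := complex.Re _ => E3 E2.
(* By [E4] the torsion of the real parts of z and z' is (c / 2) T; the vectors are twice these real
   parts, which multiplies it by 4. *)
exists (2 * c).
have E4 : torsion nabla (re_vf Z) (re_vf W) q = 2^-1 *: (c *: T q).
  have alg (a b b' x : 'rV[R]_(2 * n).+1) : b' = - b -> a - b = 0 -> a - b' = x -> a = 2^-1 *: x.
    move=> -> /eqP; rewrite subr_eq0 => /eqP <- <-.
    by apply/rowP => i; rewrite !mxE; field.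
  exact: alg t4 E1 (etrans E2 E3).
apply: (etrans (linear_funZ (torsion_at_linl cn q _) _ _)).
apply: (etrans (f_equal (fun x => 2 *: x) (linear_funZ (torsion_at_linr cn q _) _ _))).
have E5 : torsion_at nabla q (re_vec z) (re_vec z') = 2^-1 *: (c *: T q).
  by rewrite -Zq -Wq; exact: etrans (esym t1) E4.
apply: (etrans (f_equal (fun x => 2 *: (2 *: x)) E5)).
by rewrite !scalerA; congr (_ *: _); field.
Qed.

(** The torsion of X and Y is k T by [torsion_at_vertical]; pairing with theta gives k = 2 dtheta(X,
    Y), so the constant in the complex axiom never has to be evaluated. *)
Lemma lie_Hb V X Y q : open V -> V q -> smooth_vf V X -> smooth_vf V Y ->
  (forall r, V r -> Hb r (X r)) -> (forall r, V r -> Hb r (Y r)) ->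
  lie X Y q = cov nabla X Y q - cov nabla Y X q -
    (2 * extder theta q (X q) (Y q)) *: T q.
Proof.
move=> oV Vq sX sY HX HY.
have [k tk] := torsion_at_vertical (HX q Vq) (HY q Vq).
have tE := torsionE cn oV Vq sX sY.
have kE : k = 2 * extder theta q (X q) (Y q).
  apply: (etrans _ (theta_torsion oV Vq sX sY HX HY)).
  apply/esym; apply: (etrans (f_equal (theta q) (etrans tE tk))).
  apply: (etrans (linear_funZ (th_lin q) _ _)).
  by apply: (etrans (f_equal (fun x : R => k * x) (theta_T q))); exact: mulr1.
rewrite -kE; have alg (a b l t : 'rV[R]_(2 * n).+1) : a - b - l = t -> l = a - b - t.
  by move=> <-; rewrite opprB addrC subrK.
exact: alg (etrans tE tk).
Qed.

(** * Linear algebra and smoothness from an orthonormal frame of H(M) *)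

Section Frame.
Variables (U : set M) (E : 'I_(2 * n) -> vfield M).
Hypotheses (oU : open U) (E_frame : is_orthonormal_Hframe theta U E).

Let sE j : smooth_vf U (E j). Proof. by have [] := E_frame. Qed.
Lemma frame_Hb q j : U q -> Hb q (E j q).
Proof. by move=> Uq; have [_ /(_ q Uq)[]] := E_frame. Qed.

Lemma frame_orth q j k : U q -> g q (E j q) (E k q) = (j == k)%:R.
Proof.
move=> Uq; have [_ /(_ q Uq)[_ <-]] := E_frame.
by rewrite webster_Hb//; exact: frame_Hb.
Qed.

(** T at index 0 completes the frame to a basis of the tangent space that is orthonormal for the
    Webster metric. *)
Let F q (i : 'I_(2 * n).+1) : 'rV[R]_(2 * n).+1 :=
  oapp (fun j => E j q) (T q) (unlift ord0 i).

Let F0 q : F q ord0 = T q. Proof. by rewrite /F unlift_none. Qed.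
Let FS q j : F q (lift ord0 j) = E j q. Proof. by rewrite /F liftK. Qed.

Let F_orth q i j : U q -> g q (F q i) (F q j) = (i == j)%:R.
Proof.
move=> Uq; case: (unliftP ord0 i) => [i'|] ->; case: (unliftP ord0 j) => [j'|] ->.
- by rewrite !FS frame_orth// (inj_eq lift_inj).
- rewrite FS F0 webster_T; have /Hb_theta-> := frame_Hb i' Uq.
  by rewrite eq_sym (negbTE (neq_lift _ _)).
- rewrite FS F0 websterT; have /Hb_theta-> := frame_Hb j' Uq.
  by rewrite (negbTE (neq_lift _ _)).
- by rewrite F0 webster_T theta_T eqxx.
Qed.

(* The symmetry of the Levi form is a consequence of the orthonormal frame. *)
Lemma webster_sym q v w : U q -> g q v w = g q w v.
Proof.
move=> Uq.
exact: (orthonormal_sym (webster_linl q) (webster_linr q) (fun i j => F_orth i j Uq)).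
Qed.

Lemma frame_expansion q v : U q -> Hb q v -> v = \sum_j g q v (E j q) *: E j q.
Proof.
move=> Uq /Hb_theta v0.
rewrite [LHS](orthonormal_expansion (webster_linl q) (fun i j => F_orth i j Uq)).
rewrite big_ord_recl F0 webster_T v0 scale0r add0r.
by apply: eq_bigr => j _; rewrite FS.
Qed.

Lemma frame_trace q (phi : 'rV[R]_(2 * n).+1 -> 'rV[R]_(2 * n).+1) : U q ->
  linear phi ->
  \tr (lin1_mx phi) = theta q (phi (T q)) + \sum_j g q (phi (E j q)) (E j q).
Proof.
move=> Uq lphi.
rewrite (orthonormal_trace (webster_linl q) (fun i j => F_orth i j Uq) lphi).
rewrite big_ord_recl F0 webster_T; congr (_ + _).
by apply: eq_bigr => j _; rewrite FS.
Qed.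

Lemma webster_frame q v w : U q -> Hb q v ->
  g q v w = \sum_j g q v (E j q) * g q (E j q) w.
Proof.
move=> Uq Hv; rewrite [in LHS](frame_expansion Uq Hv).
exact: (linear_fun_sum (webster_linl q w)).
Qed.

(** By symmetry g(J v, w) = g(w, J v) = dtheta(w, J J v), and J J = -1 on H(M). *)
Lemma webster_Jl q v w : U q -> Hb q v -> Hb q w ->
  g q (JH q v) w = extder theta q v w.
Proof.
move=> Uq Hv Hw; apply: (etrans (webster_sym _ _ Uq)).
apply: (etrans (webster_Hb Hw (JH_Hb Hv))).
apply: (etrans (f_equal (extder theta q w) (JHK Hv))).
apply: (etrans (linear_funN (extder_linr th1 q w) v)).
exact/esym/extderC.
Qed.

Lemma webster_Jr q v w : U q -> Hb q v -> Hb q w ->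
  g q v (JH q w) = - extder theta q v w.
Proof.
move=> Uq Hv Hw; apply: (etrans (webster_Hb Hv (JH_Hb Hw))).
apply: (etrans (f_equal (extder theta q v) (JHK Hw))).
exact: (linear_funN (extder_linr th1 q v) w).
Qed.

Lemma smooth_extder X Y : smooth_vf U X -> smooth_vf U Y ->
  smooth_on U (fun r => extder theta r (X r) (Y r)).
Proof.
move=> sX sY; have so Z W : smooth_vf U Z -> smooth_vf U W ->
    smooth_on U (vder Z (fun r => theta r (W r))).
  by move=> sZ sW; apply: (smooth_vder oU sZ); exact: smooth_oneform.
have := smooth_onZ 2^-1 oU (smooth_onB oU (smooth_onB oU (so X Y sX sY) (so Y X sY sX))
  (smooth_oneform th1 oU (smooth_lie oU sX sY))).
apply: (eq_smooth_on oU) => r Ur; exact: (extder_vfE th1 oU Ur sX sY).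
Qed.

(* J X = sum_j dtheta(X, E_j) E_j, whose coefficients are smooth because dtheta is. *)
Lemma smooth_Jvf X : smooth_vf U X -> (forall r, U r -> Hb r (X r)) ->
  smooth_vf U (Jvf theta T X).
Proof.
move=> sX HX.
have se j := smooth_extder sX (sE j).
apply: eq_smooth_vf oU _ (smooth_vf_sum (index_enum 'I_(2 * n)) oU se sE) => q Uq.
have HXq := HX q Uq.
rewrite /Jvf JextE// [RHS](frame_expansion Uq (JH_Hb HXq)).
by apply: eq_bigr => j _; rewrite webster_Jl//; exact: frame_Hb.
Qed.

Lemma smooth_webster X Y : smooth_vf U X -> smooth_vf U Y ->
  (forall r, U r -> Hb r (X r)) -> (forall r, U r -> Hb r (Y r)) ->
  smooth_on U (fun r => g r (X r) (Y r)).
Proof.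
move=> sX sY HX HY; apply: (eq_smooth_on oU _ (smooth_extder sX (smooth_Jvf sY HY))).
by move=> q Uq; rewrite (webster_Hb (HX q Uq) (HY q Uq)) /Jvf (JextE (HY q Uq)).
Qed.

(** * Horizontal gradient, divergence, Hessian and Ricci trace in the frame *)

Lemma hgrad_Hb h q : Hb q (hgrad theta T h q).
Proof. exact: piH_Hb. Qed.

Lemma hgradE h q w : U q -> smooth_on U h -> Hb q w ->
  g q (hgrad theta T h q) w = dirder h q w.
Proof.
move=> Uq sh Hw.
pose S := [set x | forall v, g q x v = dirder h q v].
(* The Riesz vector of dh in the basis [F] shows that the set in [gradient] is inhabited, so its
   default value 0 is not taken by accident. *)
have ex : S (\sum_i dirder h q (F q i) *: F q i).
  move=> v; apply: (etrans (linear_fun_sum (webster_linl q v) _ _ _)).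
  have vE := orthonormal_expansion (webster_linl q) (fun i j => F_orth i j Uq) v.
  apply: (etrans _ (esym (f_equal (dirder h q) vE))).
  apply: (etrans _ (esym (dirder_sumv _ _ _ sh Uq))).
  apply: eq_bigr => i _; apply: (etrans (mulrC _ _)).
  by apply: (f_equal (fun x => x * dirder h q (F q i))); exact: webster_sym.
have G : S (gradient g h q) by exact: (xgetPex 0 (ex_intro _ _ ex)).
apply: (etrans (linear_funB (webster_linl q w) _ _)).
have A := linear_funZ (webster_linl q w) (theta q (gradient g h q)) (T q).
have B := etrans (websterT q w) ((Hb_theta q w).1 Hw).
have alg (x y a b t : R) : x = a -> y = t * b -> b = 0 -> x - y = a.
  by move=> -> -> ->; rewrite mulr0 subr0.
exact: alg (G w) A B.
Qed.

Lemma hgrad_unique h q v : U q -> smooth_on U h -> Hb q v ->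
  (forall j, g q v (E j q) = dirder h q (E j q)) -> hgrad theta T h q = v.
Proof.
move=> Uq sh Hv vE; rewrite (frame_expansion Uq (hgrad_Hb h q)).
rewrite [RHS](frame_expansion Uq Hv); apply: eq_bigr => j _; congr (_ *: _).
exact: (etrans (hgradE Uq sh (frame_Hb j Uq)) (esym (vE j))).
Qed.

Lemma smooth_hgrad h : smooth_on U h -> smooth_vf U (hgrad theta T h).
Proof.
move=> sh; have sv j := smooth_vder oU (sE j) sh.
apply: eq_smooth_vf oU _ (smooth_vf_sum (index_enum 'I_(2 * n)) oU sv sE) => q Uq.
rewrite [RHS](frame_expansion Uq (hgrad_Hb h q)); apply: eq_bigr => j _.
by congr (_ *: _); exact/esym/(hgradE Uq sh (frame_Hb j Uq)).
Qed.

Lemma metric_unit (c : connection M) Y q v : is_metric_connection g c -> U q ->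
  smooth_vf U Y -> (forall r, U r -> g r (Y r) (Y r) = 1) -> g q (c q v Y) (Y q) = 0.
Proof.
move=> mc Uq sY Y1; have A := mc U Y Y q v oU Uq sY sY.
have B := eq0_vder v oU Uq Y1.
have alg (a b x : R) : a = b -> x = a + b -> x = 0 -> a = 0 by move=> -> -> ?; lra.
exact: alg (webster_sym _ _ Uq) A B.
Qed.

(** In 2 dtheta(T, X) = 0 both derivative terms vanish, as theta(X) = 0 and theta(T) = 1 are
    constant; what is left is -theta([T, X]). *)
Lemma theta_lie_T X q : U q -> smooth_vf U X -> (forall r, U r -> Hb r (X r)) ->
  theta q (lie T X q) = 0.
Proof.
move=> Uq sX HX.
have A := etrans (extder_vfE th1 oU Uq (smooth_T U) sX) (extder_T q (X q)).
have A1 : vder T (fun r => theta r (X r)) q = 0.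
  by apply: (eq0_vder (a := 0) _ oU Uq) => r /HX/Hb_theta.
have A2 : vder X (fun r => theta r (T r)) q = 0.
  by apply: (eq0_vder (a := 1) _ oU Uq) => r _; exact: theta_T.
have alg (a b c : R) : a = 0 -> b = 0 -> 2^-1 * (a - b - c) = 0 -> c = 0.
  by move=> -> -> ?; lra.
exact: alg A1 A2 A.
Qed.

(* For a metric connection and a unit field F, the term g(nabla_F X, F) equals
   g([F, X], F) up to the F-component of the torsion; this compares D and nabla. *)
Lemma divergence_frame X q : U q -> smooth_vf U X -> (forall r, U r -> Hb r (X r)) ->
  divergence D X q = \sum_j g q (nabla q (E j q) X) (E j q).
Proof.
move=> Uq sX HX; have [Dc Dm Dt] := D_lc.
apply: (etrans (frame_trace Uq (conn_linear Dc oU Uq sX))).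
have lc Y : smooth_vf U Y -> (forall r, U r -> g r (Y r) (Y r) = 1) ->
    g q (D q (Y q) X) (Y q) = g q (lie Y X q) (Y q).
  move=> sY Y1; have t0 := Dt U Y X q oU Uq sY sX.
  have alg (a b l : 'rV[R]_(2 * n).+1) : a - b - l = 0 -> a = b + l.
    by move=> /eqP; rewrite subr_eq0 => /eqP <-; rewrite addrC subrK.
  apply: (etrans (f_equal (fun x => g q x (Y q)) (alg _ _ _ t0))).
  apply: (etrans (linear_funD (webster_linl q (Y q)) _ _)).
  apply: (etrans (f_equal (fun x => x + _) (metric_unit (X q) Dm Uq sY Y1))).
  exact: add0r.
have T1 r : U r -> g r (T r) (T r) = 1.
  by move=> _; apply: (etrans (webster_T r (T r))); exact: theta_T.
have E1 j r : U r -> g r (E j r) (E j r) = 1.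
  by move=> Ur; rewrite frame_orth// eqxx.
(* The T-entry of the trace is g(D_T X, T) = theta([T, X]), which is 0. *)
have AT : theta q (D q (T q) X) = 0.
  apply: (etrans (esym (webster_T q _))); apply: (etrans (lc T (smooth_T U) T1)).
  by apply: (etrans (webster_T q _)); exact: theta_lie_T.
apply: (etrans (f_equal (fun x => x + _) AT)); apply: (etrans (add0r _)).
apply: eq_bigr => j _; apply: (etrans (lc (E j) (sE j) (E1 j))).
have HE r : U r -> Hb r (E j r) by exact: frame_Hb.
(* In g([E_j, X], E_j) the term g(nabla_X E_j, E_j) vanishes because E_j has constant length, and
   the T-part is orthogonal to E_j. *)
have L := lie_Hb oU Uq (sE j) sX HE HX.
apply: (etrans (f_equal (fun x => g q x (E j q)) L)).
apply: (etrans (linear_funB (webster_linl q (E j q)) _ _)).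
have A1 := linear_funB (webster_linl q (E j q)) (cov nabla (E j) X q) (cov nabla X (E j) q).
have A2 := metric_unit (X q) (tw_metric nabla_tw) Uq (sE j) (E1 j).
have A3 := linear_funZ (webster_linl q (E j q)) (2 * extder theta q (E j q) (X q)) (T q).
have A4 := etrans (websterT q (E j q)) ((Hb_theta q (E j q)).1 (HE q Uq)).
have alg (x y a b t k : R) : x = a - b -> b = 0 -> y = k * t -> t = 0 -> x - y = a.
  by move=> -> -> -> ->; rewrite mulr0 !subr0.
exact: alg A1 A2 A3 A4.
Qed.

Lemma smooth_cov X Y : smooth_vf U X -> smooth_vf U Y -> smooth_vf U (cov nabla X Y).
Proof. exact: conn_smooth. Qed.

(** By metric compatibility g(nabla_X u, Y) = X(Y h) - (nabla_X Y) h for u = grad^H h. The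
    antisymmetric part is [X, Y] h minus (nabla_X Y - nabla_Y X) h, and [lie_Hb] reduces it to the
    T-component of the bracket. *)
Lemma hessian_antisym h X Y q : U q -> smooth_on U h -> smooth_vf U X ->
  smooth_vf U Y -> (forall r, U r -> Hb r (X r)) -> (forall r, U r -> Hb r (Y r)) ->
  g q (nabla q (X q) (hgrad theta T h)) (Y q) -
  g q (nabla q (Y q) (hgrad theta T h)) (X q) =
  - (2 * extder theta q (X q) (Y q)) * vder T h q.
Proof.
have alg (xy yx a b c d l w t z k tf : R) : xy = a + c -> yx = b + d -> l = xy - yx ->
    l = w -> w = z - t -> z = c - d -> t = k * tf -> a - b = - k * tf.
  by move=> ? ? ? ? ? ? ?; lra.
move=> Uq sh sX sY HX HY; pose u := hgrad theta T h.
have su : smooth_vf U u by exact: smooth_hgrad.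
have m Z W : smooth_vf U Z -> smooth_vf U W -> (forall r, U r -> Hb r (W r)) ->
    vder Z (vder W h) q = g q (nabla q (Z q) u) (W q) + dirder h q (nabla q (Z q) W).
  move=> sZ sW HW.
  have A := tw_metric nabla_tw (Z q) oU Uq su sW.
  have B : vder Z (vder W h) q = dirder (fun r => g r (u r) (W r)) q (Z q).
    by apply: (eq_dirder _ oU Uq) => r Ur; exact/esym/(hgradE Ur sh (HW r Ur)).
  apply: (etrans B); apply: (etrans A); apply: f_equal2 => //.
  exact: (hgradE Uq sh (nabla_Hb _ oU Uq sW HW)).
have L := f_equal (dirder h q) (lie_Hb oU Uq sX sY HX HY).
have L1 := vder_lie oU Uq sX sY sh.
have lh := dirder_linear sh Uq.
have L2 := linear_funB lh (cov nabla X Y q - cov nabla Y X q)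
  ((2 * extder theta q (X q) (Y q)) *: T q).
have L3 := linear_funB lh (cov nabla X Y q) (cov nabla Y X q).
have L4 := linear_funZ lh (2 * extder theta q (X q) (Y q)) (T q).
exact: alg (m X Y sX sY HY) (m Y X sY sX HX) L1 L L2 L3 L4.
Qed.

Lemma hessianE h j k q : U q -> smooth_on U h ->
  hessian nabla h (E j) (E k) q =
  g q (nabla q (E j q) (hgrad theta T h)) (E k q).
Proof.
move=> Uq sh; have HE r : U r -> Hb r (E k r) by exact: frame_Hb.
have su := smooth_hgrad sh.
have A := tw_metric nabla_tw (E j q) oU Uq su (sE k).
have B : vder (E j) (vder (E k) h) q =
    dirder (fun r => g r (hgrad theta T h r) (E k r)) q (E j q).
  by apply: (eq_dirder _ oU Uq) => r Ur; exact/esym/(hgradE Ur sh (HE r Ur)).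
have C := hgradE Uq sh (nabla_Hb (E j q) oU Uq (sE k) HE).
have alg (x a b c e : R) : x = a -> a = b + c -> c = e -> x - e = b.
  by move=> -> -> ->; rewrite addrK.
exact: alg B A C.
Qed.

(** The T-entry of the trace drops out: H(M) is parallel, so R(T, X) X is horizontal and theta
    annihilates it. *)
Lemma ricci_frame X q : U q -> smooth_vf U X -> (forall r, U r -> Hb r (X r)) ->
  ricci nabla X X q = \sum_j g q (curvature nabla (E j) X X q) (E j q).
Proof.
move=> Uq sX HX.
apply: (etrans (frame_trace Uq (curvature_linear cn oU Uq sX sX))).
have cE Z : smooth_vf U Z ->
    curvature nabla (extend q (Z q)) X X q = curvature nabla Z X X q.
  by move=> sZ; exact/esym/(curvatureE cn oU Uq sX sX sZ).
have hc Z W : smooth_vf U W -> (forall r, U r -> Hb r (W r)) ->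
    forall r, U r -> Hb r (cov nabla Z W r).
  by move=> sW HW r Ur; exact: (nabla_Hb _ oU Ur sW HW).
have sT := smooth_T U.
have A0 : theta q (curvature nabla T X X q) = 0.
  have t1 := (Hb_theta _ _).1 (hc T _ (smooth_cov sX sX) (hc X X sX HX) q Uq).
  have t2 := (Hb_theta _ _).1 (hc X _ (smooth_cov sT sX) (hc T X sX HX) q Uq).
  have t3 := (Hb_theta _ _).1 (hc (lie T X) X sX HX q Uq).
  have l1 := linear_funB (th_lin q) (cov nabla T (cov nabla X X) q)
     (cov nabla X (cov nabla T X) q).
  apply: (etrans (linear_funB (th_lin q) _ _)).
  have alg (x y a b : R) : x = a - b -> a = 0 -> b = 0 -> y = 0 -> x - y = 0.
    by move=> -> -> -> ->; rewrite !subr0.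
  exact: alg l1 t1 t2 t3.
have AT := etrans (f_equal (theta q) (cE T sT)) A0.
apply: (etrans (f_equal (fun x => x + _) AT)); apply: (etrans (add0r _)).
by apply: eq_bigr => j _; apply: (f_equal (fun x => g q x (E j q))); exact: cE.
Qed.

(** * The Bochner formula at a point of the frame domain *)

Lemma bochner f p : smooth_on U f -> U p ->
  2^-1 * sublaplacian theta T D (sqnorm theta T (hgrad theta T f)) p =
    sqnorm_hessian nabla f E p
    + vder (hgrad theta T f) (sublaplacian theta T D f) p
    + ricci nabla (hgrad theta T f) (hgrad theta T f) p
    + 2 * Lop theta T nabla f p.
Proof.
(* Final bookkeeping. [S1] is the divergence of nabla_u u and [S2] the sum of g(nabla_u nabla_{E_j}
   u, E_j); [K] and [G] are the two halves of L f; [ff], [cf], [ac], [aw] are the double sums of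
   a_ij a_ji, c_ij a_ji, a_ij c_ij and a_ij w_ij, which combine to the squared Hessian [H]. *)
have alg (X S1 S2 K ff cf ac aw rho uD G L H t : R) :
    X = 2 * S1 + 4 * K - 4 * t * aw -> S1 = rho + S2 + (ff - cf) + 2 * G ->
    uD = S2 + ac -> L = K + G -> ff - cf - ac - 2 * t * aw = H ->
    2^-1 * X = H + uD + rho + 2 * L.
  by move=> -> -> -> -> <-; field.
have alg1 (dh a1 a2 b k y x z t : R) : dh = a1 + a2 -> a2 = a1 -> a1 - b = - (2 * k) * t ->
    x = 2 * b + y -> y = (4 * t) * z -> z = - k -> x = dh.
  by move=> -> -> e -> -> ->; rewrite mulrN; move: e; set kt := k * t; nra.
have alg3 (m : nat) (x y z : 'I_m -> R) (t : R) :
    \sum_j (2 * x j + 4 * y j - 4 * t * z j) =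
    2 * \sum_j x j + 4 * \sum_j y j - 4 * t * \sum_j z j.
  by rewrite sumrB big_split -!mulr_sumr.
have alg4 (G0 : 'rV[R]_(2 * n).+1 -> R) (W0 W1 W2 A J J' Jp : 'rV[R]_(2 * n).+1)
    (d0 d1 d2 t z : R) : linear (G0 : _ -> R^o) -> W0 = W1 + W2 ->
    W1 = d0 *: A + 2 *: J -> d0 = 0 -> W2 = d1 *: Jp + (4 * t) *: J' ->
    d1 = 4 * d2 -> G0 J' = - z ->
    G0 W0 = 2 * G0 J + 4 * (G0 Jp * d2) - 4 * t * z.
  move=> lG -> -> -> -> -> Gz; rewrite scale0r add0r !(linear_funD lG) !(linear_funZ lG).
  rewrite Gz -![_ *: (_ : R^o)]/(_ * _); ring.
have alg6 (m : nat) (r s y z v : 'I_m -> R) :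
    \sum_j (r j + s j + (y j - z j) + 2 * v j) =
    \sum_j r j + \sum_j s j + (\sum_j y j - \sum_j z j) + 2 * \sum_j v j.
  by rewrite !big_split sumrN -mulr_sumr.
have alg7 (r s1 s2 s12 l l' l12 tt y z e tv ej y' z' : R) : r = s12 - l -> s12 = s1 - s2 ->
    l = l' -> l' = l12 - tt -> l12 = y - z -> tt = (2 * e) * tv ->
    y = y' -> z = z' -> ej = - e ->
    s1 = r + s2 + (y' - z') + 2 * (tv * ej).
  by move=> -> -> -> -> -> -> -> -> ->; ring.
move=> sf Up; pose u := hgrad theta T f.
have su : smooth_vf U u by exact: smooth_hgrad.
have Hu r : U r -> Hb r (u r) by move=> _; exact: hgrad_Hb.
pose phi := vder T f.
have sphi : smooth_on U phi by apply: (smooth_vder oU _ sf); exact: smooth_T.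
have sJu : smooth_vf U (Jvf theta T u) by exact: smooth_Jvf.
have HJu r : U r -> Hb r (Jvf theta T u r).
  by move=> Ur; rewrite /Jvf (JextE (Hu r Ur)); exact: (JH_Hb (Hu r Ur)).
have HE j r : U r -> Hb r (E j r) by exact: frame_Hb.
have lE q j := webster_linl q (E j q).
have smu : smooth_vf U (cov nabla u u) by exact: smooth_cov.
have Huu r : U r -> Hb r (cov nabla u u r).
  by move=> Ur; exact: (nabla_Hb _ oU Ur su Hu).
(* [a] is the horizontal Hessian in the frame, [c] records how the frame turns along u, and [w] is
   dtheta. *)
pose a i j := g p (nabla p (E i p) u) (E j p).
pose c i j := g p (nabla p (u p) (E i)) (E j p).
pose w i j := extder theta p (E i p) (E j p).
have Ha i : Hb p (nabla p (E i p) u) by exact: (nabla_Hb _ oU Up su Hu).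
have Hc i : Hb p (nabla p (u p) (E i)) by exact: (nabla_Hb _ oU Up (sE i) (HE i)).
have HTu : Hb p (nabla p (T p) u) by exact: (nabla_Hb _ oU Up su Hu).
have aE i : nabla p (E i p) u = \sum_j a i j *: E j p by exact: frame_expansion.
have cE i : nabla p (u p) (E i) = \sum_j c i j *: E j p by exact: frame_expansion.
pose S1 := \sum_j g p (nabla p (E j p) (cov nabla u u)) (E j p).
pose S2 := \sum_j g p (nabla p (u p) (cov nabla (E j) u)) (E j p).
pose K := vder (Jvf theta T u) phi p.
pose G := g p (nabla p (T p) u) (JH p (u p)).
have F1 : sublaplacian theta T D (sqnorm theta T u) p =
    2 * S1 + 4 * K - 4 * phi p * \sum_i \sum_j a i j * w i j.
  pose h := sqnorm theta T u.
  have sh : smooth_on U h by exact: (smooth_webster su su Hu Hu).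
  (* E_j |u|^2 = 2 g(nabla_{E_j} u, u). Exchanging E_j and u costs -4 dtheta(E_j, u) Tf = 4 (Tf) g(J
     u, E_j), hence the coefficient 4. The equality with the gradient is needed on all of U because
     it is differentiated at p. *)
  pose W q := 2 *: cov nabla u u q + (4 * phi q) *: Jvf theta T u q.
  have WE q : U q -> hgrad theta T h q = W q.
    move=> Uq; apply: (hgrad_unique Uq sh) => [|j].
      exact: HbD (HbZ _ (Huu q Uq)) (HbZ _ (HJu q Uq)).
    have He := HE j q Uq.
    have A1 := tw_metric nabla_tw (E j q) oU Uq su su.
    have A2 := webster_sym (u q) (nabla q (E j q) u) Uq.
    have A3 := hessian_antisym Uq sf (sE j) su (HE j) Hu.
    have A4 := linear_funD (lE q j) (2 *: cov nabla u u q) ((4 * phi q) *: Jvf theta T u q).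
    have A5 := linear_funZ (lE q j) 2 (cov nabla u u q).
    have A6 := linear_funZ (lE q j) (4 * phi q) (Jvf theta T u q).
    have A7 : g q (Jvf theta T u q) (E j q) = - extder theta q (E j q) (u q).
      apply: (etrans (f_equal (fun x => g q x (E j q)) (JextE (Hu q Uq)))).
      exact: (etrans (webster_Jl Uq (Hu q Uq) He) (extderC _ _ _ _)).
    apply: (alg1 _ _ _ _ _ _ _ _ _ A1 A2 A3 _ A6 A7).
    by apply: (etrans A4); exact: (f_equal (fun x => x + _) A5).
  have sW1 := smooth_vfZ oU (smooth_on_cst U 2) smu.
  have s4 := smooth_onZ 4 oU sphi.
  have sW2 := smooth_vfZ oU s4 sJu.
  have sW : smooth_vf U W by exact: smooth_vfD.
  have sW' : smooth_vf U (hgrad theta T h) by exact: smooth_hgrad.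
  have HW' r : U r -> Hb r (hgrad theta T h r) by move=> _; exact: hgrad_Hb.
  apply: (etrans (divergence_frame Up sW' HW')).
  have KE : K = \sum_j g p (Jvf theta T u p) (E j p) * vder (E j) phi p.
    apply: (etrans (f_equal (dirder phi p) (frame_expansion Up (HJu p Up)))).
    exact: (dirder_sumv _ _ _ sphi Up).
  rewrite KE; apply: (etrans _ (alg3 _ _ _ _ _)); apply: eq_bigr => j _.
  have B0 : nabla p (E j p) (hgrad theta T h) = nabla p (E j p) W.
    exact: (conn_local cn _ oU Up sW' sW WE).
  have B1 := conn_additive cn (E j p) oU Up sW1 sW2.
  have B2 := conn_leibniz cn (E j p) oU Up (smooth_on_cst U 2) smu.
  have B3 := conn_leibniz cn (E j p) oU Up s4 sJu.
  have B4 := dirder_cst (M := M) 2 p (E j p).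
  have B5 := dirderZ 4 (E j p) sphi Up.
  have B6 : nabla p (E j p) (Jvf theta T u) = JH p (nabla p (E j p) u).
    apply: (etrans (tw_J_parallel nabla_tw (E j p) oU Up su)).
    exact: (JextE (Ha j)).
  (* J commutes with nabla, so summing this over j gives div(J u), which is minus the sum of a_jk
     w_jk. *)
  have B7 : g p (JH p (nabla p (E j p) u)) (E j p) = - \sum_k a j k * w j k.
    apply: (etrans (webster_Jl Up (Ha j) (HE j p Up))).
    apply: (etrans (f_equal (fun x => extder theta p x (E j p)) (aE j))).
    apply: (etrans (linear_fun_sum (extder_linl th1 p (E j p)) _ _ _)).
    rewrite -sumrN; apply: eq_bigr => k _.
    apply: (etrans (f_equal (fun x => a j k * x) (extderC th1 p _ _))).
    exact: mulrN.
  exact: (alg4 (g p ^~ (E j p)) _ _ _ _ _ _ _ _ _ _ _ _ (lE p j)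
    (etrans B0 B1) B2 B4 B3 B5 (etrans (f_equal (g p ^~ (E j p)) B6) B7)).
(* Definition of R(E_j, u) u, traced over j. In [E_j, u], the part nabla_{E_j} u gives the a_jk
   a_kj, nabla_u E_j gives the c_jk a_kj, and -2 dtheta(E_j, u) T = 2 g(E_j, J u) T sums to 2 G. *)
have F2 : S1 = ricci nabla u u p + S2 +
    (\sum_i \sum_j a i j * a j i - \sum_i \sum_j c i j * a j i) + 2 * G.
  have GE j : linear (fun v => g p (nabla p v u) (E j p) : R^o).
    move=> k v v'; apply: (etrans (f_equal (g p ^~ (E j p)) (conn_linear cn oU Up su k v v'))).
    exact: lE.
  have GS : G = \sum_j g p (nabla p (T p) u) (E j p) * g p (E j p) (JH p (u p)).
    exact: (webster_frame _ Up HTu).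
  rewrite (ricci_frame Up su Hu) GS; apply: (etrans _ (alg6 _ _ _ _ _ _)).
  apply: eq_bigr => j _.
  have L := lie_Hb oU Up (sE j) su (HE j) Hu.
  have C0 := linear_funB (GE j) (cov nabla (E j) u p - cov nabla u (E j) p)
     ((2 * extder theta p (E j p) (u p)) *: T p).
  have C1 := linear_funB (GE j) (cov nabla (E j) u p) (cov nabla u (E j) p).
  have C2 := linear_funZ (GE j) (2 * extder theta p (E j p) (u p)) (T p).
  have C3 : g p (nabla p (cov nabla (E j) u p) u) (E j p) = \sum_k a j k * a k j.
    apply: (etrans (f_equal (fun v => g p (nabla p v u) (E j p)) (aE j))).
    exact: (linear_fun_sum (GE j)).
  have C4 : g p (nabla p (cov nabla u (E j) p) u) (E j p) = \sum_k c j k * a k j.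
    apply: (etrans (f_equal (fun v => g p (nabla p v u) (E j p)) (cE j))).
    exact: (linear_fun_sum (GE j)).
  have C5 := webster_Jr Up (HE j p Up) (Hu p Up).
  have C6 := linear_funB (lE p j) (cov nabla (E j) (cov nabla u u) p -
      cov nabla u (cov nabla (E j) u) p) (cov nabla (lie (E j) u) u p).
  have C7 := linear_funB (lE p j) (cov nabla (E j) (cov nabla u u) p)
    (cov nabla u (cov nabla (E j) u) p).
  have C8 := f_equal (fun v => g p (nabla p v u) (E j p)) L.
  exact: (alg7 _ _ _ _ _ _ _ _ _ _ _ _ _ _ _ C6 C7 C8 C0 C1 C2 C3 C4 C5).
(* The product rule also differentiates the frame: the terms g(nabla_{E_i} u, nabla_u E_i) are the
   sum of a_ij c_ij. *)
have F3 : vder u (sublaplacian theta T D f) p = S2 + \sum_i \sum_j a i j * c i j.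
  have E0 : vder u (sublaplacian theta T D f) p =
      dirder (fun q => \sum_j g q (cov nabla (E j) u q) (E j q)) p (u p).
    by apply: (eq_dirder _ oU Up) => r Ur; exact: (divergence_frame Ur su Hu).
  have sEu j := conn_smooth cn oU (sE j) su.
  have HEu j r : U r -> Hb r (cov nabla (E j) u r).
    by move=> Ur; exact: (nabla_Hb _ oU Ur su Hu).
  have sg j : smooth_on U (fun q => g q (cov nabla (E j) u q) (E j q)).
    exact: (smooth_webster (sEu j) (sE j) (HEu j) (HE j)).
  apply: (etrans E0); apply: (etrans (dirder_sum _ _ oU sg Up)).
  rewrite -big_split; apply: eq_bigr => i _.
  apply: (etrans (tw_metric nabla_tw (u p) oU Up (sEu i) (sE i))).
  apply: f_equal2 => //; apply: (etrans (webster_frame _ Up (Ha i))).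
  apply: eq_bigr => j _; apply: (f_equal (fun x => a i j * x)).
  exact: webster_sym.
have GE : G = extder theta p (u p) (nabla p (T p) u).
  apply: (etrans (webster_Jr Up HTu (Hu p Up))).
  exact/esym/extderC.
(* (J nabla_T u)(f) = g(u, J nabla_T u) = -G, as J is skew for g; the minus sign in [Lop] turns it
   into +G. *)
have F4 : Lop theta T nabla f p = K + G.
  have A : vder (Jvf theta T (cov nabla T u)) f p = - G.
    have HJ := JH_Hb HTu.
    apply: (etrans (f_equal (dirder f p) (JextE HTu))).
    apply: (etrans (esym (hgradE Up sf HJ))).
    apply: (etrans (webster_Jr Up (Hu p Up) HTu)).
    exact: (f_equal -%R (esym GE)).
  apply: (etrans (f_equal (fun x => K - x) A)); exact: (f_equal (fun x => K + x) (opprK G)).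
(* Differentiate the constant g(E_i, E_j) along u. *)
have cC i j : c i j = - c j i.
  have Eij r : U r -> g r (E i r) (E j r) = (i == j)%:R by exact: frame_orth.
  have A := etrans (esym (tw_metric nabla_tw (u p) oU Up (sE i) (sE j)))
     (eq0_vder (u p) oU Up Eij).
  have B : g p (E i p) (nabla p (u p) (E j)) = c j i by exact: webster_sym.
  by apply/eqP; rewrite -addr_eq0; apply/eqP; exact: (etrans (f_equal (fun x => c i j + x) (esym B)) A).
have aC i j : a i j - a j i = - (2 * w i j) * phi p.
  exact: (hessian_antisym Up sf (sE i) (sE j) (HE i) (HE j)).
have F5 := bochner_algebra cC aC.
have F6 : sqnorm_hessian nabla f E p = \sum_i \sum_j a i j ^+ 2.
  apply: eq_bigr => i _; apply: eq_bigr => j _.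
  by apply: (f_equal (fun x => x ^+ 2)); exact: hessianE.
exact: (alg _ _ _ _ _ _ _ _ _ _ _ _ _ _ F1 F2 F3 F4 (etrans F5 (esym F6))).
Qed.

End Frame.
End Pseudohermitian.

Theorem mainTheorem1 (R : realType) (n : nat) (M : crManifold R n)
    (theta : oneform M) (T : vfield M) (nabla D : connection M)
    (M_compact : compact [set: M])
    (theta_psh : is_pseudohermitian theta)
    (theta_pos : levi_posdef theta)
    (T_char : is_characteristic theta T)
    (nabla_tw : is_tanaka_webster theta T nabla)
    (D_lc : is_levi_civita (webster theta T) D)
    (f : M -> R) (f_smooth : smooth_on setT f)
    (U : set M) (E : 'I_(2 * n) -> vfield M)
    (U_open : open U) (E_frame : is_orthonormal_Hframe theta U E)
    (p : M) (Up : U p) :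
  2^-1 * sublaplacian theta T D (sqnorm theta T (hgrad theta T f)) p =
    sqnorm_hessian nabla f E p
    + vder (hgrad theta T f) (sublaplacian theta T D f) p
    + ricci nabla (hgrad theta T f) (hgrad theta T f) p
    + 2 * Lop theta T nabla f p.
Proof.
have sf : smooth_on U f by exact: sub_smooth_on f_smooth.
exact: (bochner theta_psh T_char nabla_tw D_lc U_open E_frame sf Up).
Qed.
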